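(* The couple $(T(l_1),T(l_2))$ is a $\mathcal{K}$-subcouple of the couple $(L_\infty,G)$. In other words, $$\mathcal{K}(t,Ta;L_\infty,G)\asymp \mathcal{K}(t,a;l_1,l_2),$$ i.e. there are two-sided estimates between the two quantities with constants independent of $a=(a_k)_{k=1}^\infty\in l_2$ and $t>0$.
   Context: All function spaces consist of measurable functions on $[0,1]$ with Lebesgue measure. The Rademacher functions are $r_k(t)=\operatorname{sign}\sin(2^{k-1}\pi t)$, $k=1,2,\dots$, $t\in[0,1]$. For $a=(a_k)_{k=1}^\infty\in l_2$ (real sequences) put $Ta=\sum_{k=1}^\infty a_k r_k$ (the series converges almost everywhere). Here $l_p$ has norm $\|a\|_p=(\sum_{k=1}^\infty|a_k|^p)^{1/p}$. For a nonnegative convex continuous function $S$ on $[0,\infty)$ with $S(0)=0$, the Orlicz space $L_S$ consists of all measurable $x$ on $[0,1]$ with $\|x\|_S=\inf\{u>0:\int_0^1 S(|x(t)|/u)\,dt\le 1\}<\infty$. Let $N(t)=\exp(t^2)-1$, and let $G$ be the closure of $L_\infty$ in $L_N$, with the norm of $L_N$. For a Banach couple $(X_0,X_1)$, $x\in X_0+X_1$ and $t>0$, the Peetre functional is $$\mathcal{K}(t,x;X_0,X_1)=\inf\{\|x_0\|_{X_0}+t\|x_1\|_{X_1}: x=x_0+x_1,\ x_0\in X_0,\ x_1\in X_1\}.$$ If $Y_i$ is a subspace of $X_i$ ($i=0,1$), the couple $(Y_0,Y_1)$ is called a $\mathcal{K}$-subcouple of $(X_0,X_1)$ if $\mathcal{K}(t,y;Y_0,Y_1)\asymp\mathcal{K}(t,y;X_0,X_1)$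 with constants independent of $y\in Y_0+Y_1$ and $t>0$. Here $T(l_1)$ is regarded as a subspace of $L_\infty$ and $T(l_2)$ as a subspace of $G$. The symbol $\asymp$ means two-sided estimates up to positive multiplicative constants. *)

(* Defs.v *)
From mathcomp Require Import all_boot all_order all_algebra.
From mathcomp Require Import all_classical all_reals all_analysis.

Set Implicit Arguments.
Unset Strict Implicit.
Unset Printing Implicit Defensive.

Import Order.TTheory GRing.Theory Num.Theory.
Import numFieldNormedType.Exports.

Local Open Scope classical_set_scope.
Local Open Scope ring_scope.

(* A normed space is given by the set of its elements inside an ambient vector
   space and by its norm.  The norm takes values in the extended reals because
   the norms used below are defined on the whole ambient space; only their
   values on the set of elements matter. *)
Record nspace (R : realType) (V : lmodType R) := NSpace {
  elts : set V ;
  nrm : V -> \bar R }.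

(* In the next definitions [eqv] is the equality of elements: Leibniz equality
   for sequences, equality almost everywhere on [0, 1] for functions. *)

Definition sum_space (R : realType) (V : lmodType R) (eqv : V -> V -> Prop)
    (X0 X1 : nspace V) : set V :=
  [set x | exists x0 x1, [/\ elts X0 x0, elts X1 x1 & eqv x (x0 + x1)]].

Definition K_functional (R : realType) (V : lmodType R) (eqv : V -> V -> Prop)
    (X0 X1 : nspace V) (t : R) (x : V) : \bar R :=
  ereal_inf [set (nrm X0 z.1 + t%:E * nrm X1 z.2)%E | z in
    [set z : V * V | [/\ elts X0 z.1, elts X1 z.2 & eqv x (z.1 + z.2)]]].

Definition asymp (R : realType) (V : Type) (D : set V)
    (F H : R -> V -> \bar R) : Prop :=
  exists c C : R, [/\ 0 < c, 0 < C & forall (x : V) (t : R), D x -> 0 < t ->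
    (c%:E * F t x <= H t x)%E /\ (H t x <= C%:E * F t x)%E].

Definition is_subspace (R : realType) (V : lmodType R) (Y X : nspace V) : Prop :=
  [/\ elts Y `<=` elts X,
      elts Y 0,
      forall (c : R) (x y : V), elts Y x -> elts Y y -> elts Y (c *: x + y)
    & forall y, elts Y y -> nrm Y y = nrm X y].

Definition K_subcouple (R : realType) (V : lmodType R) (eqv : V -> V -> Prop)
    (Y0 Y1 X0 X1 : nspace V) : Prop :=
  [/\ is_subspace Y0 X0, is_subspace Y1 X1
    & asymp (sum_space eqv Y0 Y1)
        (K_functional eqv Y0 Y1) (K_functional eqv X0 X1)].

(* A measurable function on [0, 1] is represented by a function on R that is
   Borel measurable on [0, 1]; its values outside [0, 1] are irrelevant.  Every
   Lebesgue measurable function is almost everywhere equal to a Borel one, so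
   the classes modulo [ae01] are the same. *)

Definition meas01 (R : realType) (f : R -> R) : Prop :=
  measurable_fun (`[0, 1]%classic : set R) f.

Definition ae01 (R : realType) (f g : R -> R) : Prop :=
  ae_eq (@lebesgue_measure R) `[0, 1]%classic f g.

Definition leb01 (R : realType) : {measure set (measurableTypeR R) -> \bar R} :=
  mrestr (@lebesgue_measure R) (@measurable_itv R `[0, 1]).

Definition Linfty (R : realType) : nspace (R -> R) :=
  let norm := fun f : R -> R => Lnorm (leb01 R) +oo%E (EFin \o f) in
  NSpace [set f | meas01 f /\ (norm f < +oo)%E] norm.

Definition orlicz_norm (R : realType) (S : R -> R) (x : R -> R) : \bar R :=
  ereal_inf [set u%:E | u in [set u : R | 0 < u /\
    (\int[@lebesgue_measure R]_(t in `[0%R, 1%R]) (S (`|x t| / u))%:E <= 1)%E]].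

Definition orlicz (R : realType) (S : R -> R) : nspace (R -> R) :=
  NSpace [set x | meas01 x /\ (orlicz_norm S x < +oo)%E]
    (orlicz_norm S).

Definition nclosure (R : realType) (V : lmodType R) (A : set V) (X : nspace V) :
    nspace V :=
  NSpace [set x | elts X x /\ forall e : R, 0 < e ->
    exists y, [/\ A y, elts X y & (nrm X (x - y) < e%:E)%E]] (nrm X).

Definition expsq (R : realType) (t : R) : R := expR (t ^+ 2) - 1.

Definition Gspace (R : realType) : nspace (R -> R) :=
  nclosure (elts (Linfty R)) (orlicz (@expsq R)).

(* Sequences are indexed from 0, so that [a k] and [rademacher k] are the terms
   a_(k+1) and r_(k+1) of the sequences indexed from 1. *)

Definition rademacher (R : realType) (k : nat) (t : R) : R :=
  Num.sg (sin (2 ^+ k * pi * t)).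

(* For a in l_2 the series converges at almost every t in [0, 1]; the value of
   [limn] at the other points is irrelevant. *)
Definition rsum (R : realType) (a : nat -> R) (t : R) : R :=
  limn (series (fun k => a k * rademacher k t)).

Definition lnorm (R : realType) (p : R) (a : nat -> R) : \bar R :=
  ((\sum_(0 <= k <oo) (`|a k| `^ p)%:E) `^ p^-1)%E.

Definition lspace (R : realType) (p : R) : nspace (nat -> R) :=
  NSpace [set a | (lnorm p a < +oo)%E] (lnorm p).

(* The image of [A] under [rsum], saturated for [ae01], with the norm of [X]. *)
Definition rsum_image (R : realType) (A : set (nat -> R)) (X : nspace (R -> R)) :
    nspace (R -> R) :=
  NSpace [set f | meas01 f /\ exists2 a, A a & ae01 f (rsum a)]
    (nrm X).

(* Main.v *)
Require Import Defs.
From mathcomp Require Import all_boot all_order all_algebra.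
From mathcomp Require Import all_classical all_reals all_analysis.
From mathcomp Require Import measurable_realfun ess_sup_inf ring lra.

Set Implicit Arguments.
Unset Strict Implicit.
Unset Printing Implicit Defensive.

Import Order.TTheory GRing.Theory Num.Theory.
Import numFieldNormedType.Exports.

Local Open Scope classical_set_scope.
Local Open Scope ring_scope.

(** Write r_0, r_1, ... for the Rademacher functions.  As sin (pi t) > 0 on
    ]0, 1[, the function r_0 is the constant 1 there, while r_1, r_2, ... are
    independent fair signs: integrating a function of r_1, ..., r_n over [0, 1]
    amounts to averaging it over all sign vectors ([integral_rads]).  These
    averages satisfy a recursion in n, so that each probabilistic estimate
    below is an induction over the list of coefficients.

    Bounding the functional of the functions by that of the sequences.  If
    a = b + d with b in l_1 and d in l_2, then Ta = Tb + Td, and |Tb| is at most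
    the l_1 norm of b.  Averaging exp (al (x + S)^2) over one sign at a time
    shows that Rademacher sums are subgaussian ([avg_expR_sqr]); by the lemma of
    Fatou the norm of Td in L_N is at most 4 times the l_2 norm of d
    ([integral_exp_rsum], [rsum_orlicz_le]).  The same estimate for the tails of
    the series places T(l_2) in the closure G of L_oo ([rsum_G]).  Convergence
    almost everywhere, hence linearity of T, comes from the maximal inequality
    of Kolmogorov ([kolmogorov_maximal], [psum_cvg_ae]).

    Bounding the functional of the sequences by that of the functions, by
    duality.  Up to a constant, K(t, a; l_1, l_2) is the supremum of
    sum_k a_k b_k over the b with |b_k| <= 1 and l_2 norm at most t
    ([K_l1_l2_le_dual]).  For such a b, the Riesz product
    g = prod_(k >= 1) (1 + b_k r_k) is a probability density with
    int g^2 <= exp (t^2), and int Ta g = a_0 + sum_(k >= 1) a_k b_k, which is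
    at least sum_k a_k b_k if a_0 >= 0; if a_0 < 0, take
    - prod_(k >= 1) (1 - b_k r_k) instead.  Write Ta = x0 + x1.  Then
    int |x0| |g| is at most the norm of x0 in L_oo, and an inequality of Young
    type ([young_exp]) bounds int |x1| |g| by 5 t times the norm of x1 in L_N
    when t >= 1.  So sum_k a_k b_k is at most the sum of the
    two ([dual_pairing_le]).  For t < 1 it is enough to bound t times the
    l_2 norm of a, which is the same argument at t = 1 with b = a / |a|_2.

    Up to a constant, the K-functional of the couple (T(l_1), T(l_2)) lies
    between the two functionals just compared ([K_rsum_image_ge],
    [K_rsum_image_le]), which gives the statement on subcouples. *)

(** * Averages over sign vectors *)

Section sign_averages.
Context {R : realType}.
Implicit Types (n : nat) (H : seq R -> R) (c s b : seq R).

(** The mean of [H] over the 2^n sign vectors of length [n], as iterated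
    conditional expectations starting from the first sign. *)
Fixpoint avg n H : R :=
  if n is n'.+1 then
    (avg n' (fun s => H (1 :: s)) + avg n' (fun s => H (-1 :: s))) / 2
  else H [::].

Lemma avg_le n H1 H2 : (forall s, H1 s <= H2 s) -> avg n H1 <= avg n H2.
Proof.
elim: n H1 H2 => [|n IH] H1 H2 le12 /=; first exact: le12.
by rewrite ler_pM2r ?invr_gt0// lerD// IH.
Qed.

Lemma avg_cst n k : avg n (fun=> k) = k.
Proof. by elim: n => //= n ->; lra. Qed.

Lemma avgZ n k H : avg n (fun s => k * H s) = k * avg n H.
Proof. by elim: n H => //= n IH H; rewrite !IH; lra. Qed.

(** The list [s] may be longer than [c]: [zip] ignores the extra entries. *)
Definition lin c s : R := \sum_(p <- zip c s) p.1 * p.2.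

Definition sqs c : R := \sum_(x <- c) x ^+ 2.

Lemma lin_cons x c e s : lin (x :: c) (e :: s) = x * e + lin c s.
Proof. by rewrite /lin big_cons. Qed.

Lemma sqs_cons x c : sqs (x :: c) = x ^+ 2 + sqs c.
Proof. by rewrite /sqs big_cons. Qed.

Lemma sqs_ge0 c : 0 <= sqs c.
Proof. by apply: sumr_ge0 => x _; exact: sqr_ge0. Qed.

Lemma expR_leV (x : R) : x < 1 -> expR x <= (1 - x)^-1.
Proof.
move=> x1; have := expR_ge1Dx (- x); rewrite expRN => h.
by rewrite -[expR x]invrK lef_pV2// posrE ?invr_gt0 ?expR_gt0//; lra.
Qed.

(** The sharp constant is 1/2, but 2 is enough below and follows from
    1 + y <= exp y alone, applied to -x, x and 2 x^2 when |x| <= 1/2; for larger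
    x already |x| <= 2 x^2. *)
Lemma cosh_le_expR_sqr (x : R) : (expR x + expR (- x)) / 2 <= expR (2 * x ^+ 2).
Proof.
wlog x0 : x / 0 <= x.
  move=> h; have [|x0] := leP 0 x; first exact: h.
  by have := h (- x); rewrite opprK sqrrN addrC; apply; lra.
have [x12|x12] := leP x (2^-1).
  have x1 : x < 1 by lra.
  have x1' : - x < 1 by lra.
  have h1 := expR_leV x1; have h2 := expR_leV x1'.
  have h3 := expR_ge1Dx (2 * x ^+ 2).
  apply: (@le_trans _ _ (((1 - x)^-1 + (1 - - x)^-1) / 2)); first lra.
  apply: le_trans h3.
  have -> : ((1 - x)^-1 + (1 - - x)^-1) / 2 = (1 - x ^+ 2)^-1.
    by field; apply/and3P; split; apply/eqP; nra.
  have x2 : x ^+ 2 <= 2^-1 by nra.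
  have x2' := sqr_ge0 x.
  by rewrite -[leLHS]mul1r ler_pdivrMr; nra.
have h : expR (- x) <= expR x by rewrite ler_expR; lra.
apply: (@le_trans _ _ (expR x)); first lra.
by rewrite ler_expR; nra.
Qed.

(** Averaging over one sign e replaces exp (al (x + a e)^2) by
    exp (al x^2 + al a^2) cosh (2 al x a), so the exponent stays quadratic in
    x with al replaced by at most al (1 + 8 al a^2) <= al / (1 - 8 al a^2).
    The map al |-> al / (1 - 8 al y) composes additively in y, which is why
    the induction closes. *)
Lemma avg_expR_sqr (al : R) c (x : R) : 0 <= al -> 8 * al * sqs c < 1 ->
  avg (size c) (fun s => expR (al * (x + lin c s) ^+ 2)) <=
  expR (al / (1 - 8 * al * sqs c) * (x ^+ 2 + sqs c)).
Proof.
move=> al0; elim: c x => [|a c IH] x /=.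
  by rewrite /lin /sqs /= !big_nil mulr0 subr0 divr1 !addr0.
rewrite sqs_cons => lt1.
have a2 := sqr_ge0 a; have c2 := sqs_ge0 c.
have ala : 0 <= al * a ^+ 2 by rewrite mulr_ge0.
have d0 : 0 < 1 - 8 * al * sqs c by nra.
have lt1' : 8 * al * sqs c < 1 by lra.
set d := 1 - 8 * al * sqs c in d0 IH *.
set al' := al / d in IH.
have al'0 : 0 <= al' by rewrite divr_ge0// ltW.
apply: (@le_trans _ _ ((expR (al' * ((x + a) ^+ 2 + sqs c)) +
    expR (al' * ((x - a) ^+ 2 + sqs c))) / 2)).
  rewrite ler_pM2r ?invr_gt0//; apply: lerD.
    apply: le_trans (IH (x + a) lt1').
    by apply: avg_le => s; rewrite lin_cons mulr1 addrA.
  apply: le_trans (IH (x - a) lt1').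
  by apply: avg_le => s; rewrite lin_cons mulrN1 addrA.
have -> : al' * ((x + a) ^+ 2 + sqs c) =
  al' * (x ^+ 2 + a ^+ 2 + sqs c) + 2 * al' * x * a by ring.
have -> : al' * ((x - a) ^+ 2 + sqs c) =
  al' * (x ^+ 2 + a ^+ 2 + sqs c) + (- (2 * al' * x * a)) by ring.
rewrite !expRD -mulrDr -mulrA.
apply: le_trans (ler_wpM2l (expR_ge0 _) (cosh_le_expR_sqr _)) _.
rewrite -expRD ler_expR.
have d'0 : 0 < 1 - 8 * al * (a ^+ 2 + sqs c) by lra.
set d' := 1 - 8 * al * (a ^+ 2 + sqs c) in d'0 *.
have dd' : d = d' + 8 * al * a ^+ 2 by rewrite /d /d'; ring.
have key : al' + 8 * al' ^+ 2 * a ^+ 2 <= al / d'.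
  have -> : al' + 8 * al' ^+ 2 * a ^+ 2 =
    al * (d + 8 * al * a ^+ 2) / d ^+ 2.
    by rewrite /al'; field; lra.
  rewrite -mulrA ler_wpM2l// ler_pdivrMr ?exprn_gt0//.
  by rewrite ler_pdivlMl// dd'; nra.
have key0 : al' <= al / d'.
  by apply: le_trans key; rewrite lerDl; have := sqr_ge0 al'; nra.
have -> : al' * (x ^+ 2 + a ^+ 2 + sqs c) + 2 * (2 * al' * x * a) ^+ 2 =
  (al' + 8 * al' ^+ 2 * a ^+ 2) * x ^+ 2 + al' * (a ^+ 2 + sqs c) by ring.
by rewrite [leRHS]mulrDr lerD// ler_wpM2r ?sqr_ge0// addr_ge0.
Qed.

Definition riesz b s : R := \prod_(p <- zip b s) (1 + p.1 * p.2).

Lemma riesz_cons x b e s : riesz (x :: b) (e :: s) = (1 + x * e) * riesz b s.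
Proof. by rewrite /riesz big_cons. Qed.

Lemma avg_riesz b : avg (size b) (riesz b) = 1.
Proof.
elim: b => [|x b IH] /=; first by rewrite /riesz big_nil.
under [X in avg _ X]eq_fun do rewrite riesz_cons.
under [X in _ + avg _ X]eq_fun do rewrite riesz_cons.
by rewrite !avgZ IH; lra.
Qed.

(** By independence the mean is the product of the 1 + x^2 over the
    entries x of [b]. *)
Lemma avg_riesz_sqr b :
  avg (size b) (fun s => riesz b s ^+ 2) <= expR (sqs b).
Proof.
elim: b => [|x b IH] /=.
  by rewrite /riesz /sqs !big_nil expr1n expR0.
under [X in avg _ X]eq_fun do rewrite riesz_cons exprMn.
under [X in _ + avg _ X]eq_fun do rewrite riesz_cons exprMn.
rewrite !avgZ sqs_cons expRD.
set A := avg _ _ in IH *.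
have -> : ((1 + x * 1) ^+ 2 * A + (1 + x * -1) ^+ 2 * A) / 2 =
  (1 + x ^+ 2) * A by field.
apply: ler_pM => //.
- by rewrite addr_ge0// sqr_ge0.
- by rewrite -(avg_cst (size b) 0) avg_le// => s; exact: sqr_ge0.
- exact: expR_ge1Dx.
Qed.

(** Orthogonality of the signs: only the diagonal terms survive. *)
Lemma avg_lin_riesz k c b : size c = size b ->
  avg (size b) (fun s => (k + lin c s) * riesz b s) = k + lin c b.
Proof.
elim: b c k => [|x b IH] [|a c] k //=.
  by rewrite /riesz /lin !big_nil mulr1.
move=> [sz]; rewrite lin_cons.
have E e : avg (size b) (fun s =>
    (k + lin (a :: c) (e :: s)) * riesz (x :: b) (e :: s)) =
    (1 + x * e) * (k + a * e + lin c b).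
  rewrite -(IH _ _ sz) -avgZ; congr (avg _ _); apply/funext => s.
  by rewrite lin_cons riesz_cons; ring.
by rewrite !E; field.
Qed.

(** Whether the walk started at [x] with steps [a * e] ever leaves the
    interval ]-l, l[. *)
Fixpoint hit (l x : R) c s : bool :=
  (l <= `|x|) ||
  (if (c, s) is (a :: c', e :: s') then hit l (x + a * e) c' s' else false).

Lemma hit_take l x c s k : l <= `|x + lin (take k c) s| -> hit l x c s.
Proof.
elim: c x s k => [|a c IH] x [|e s] [|k] /=;
  rewrite /lin /= ?big_nil ?addr0; do ?by move=> ->.
by rewrite big_cons /= addrA => /IH ->; rewrite orbT.
Qed.

(** The maximal inequality of Kolmogorov.  Conditioning on the first step
    makes it an induction: a walk already outside the interval satisfies
    1 <= x^2 / l^2, and for the others the mean of (x + a)^2 and (x - a)^2 is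
    x^2 + a^2. *)
Lemma avg_hit l x c : 0 < l ->
  avg (size c) (fun s => (hit l x c s)%:R) <= (x ^+ 2 + sqs c) / l ^+ 2.
Proof.
move=> l0.
have big (y : R) : l <= `|y| -> 1 <= y ^+ 2 / l ^+ 2.
  move=> ly; rewrite ler_pdivlMr ?exprn_gt0// mul1r -(real_normK (num_real y)).
  by rewrite lerXn2r// ?nnegrE// ltW.
elim: c x => [|a c IH] x.
  rewrite /sqs big_nil addr0 /= orbF; case: (leP l `|x|) => [|_]; first exact: big.
  by rewrite divr_ge0// sqr_ge0.
have [lx|xl] := leP l `|x|.
  apply: (@le_trans _ _ 1).
    rewrite -[leRHS](avg_cst (size (a :: c))); apply: avg_le => s.
    by case: (hit _ _ _ _); rewrite ?ler01.
  apply: le_trans (big _ lx) _.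
  by rewrite ler_pM2r ?invr_gt0 ?exprn_gt0// lerDl sqs_ge0.
rewrite /= (lt_geF xl) /= sqs_cons.
have := IH (x + a * 1); have := IH (x + a * -1).
set A1 := avg _ _; set A2 := avg _ _ => h1 h2.
apply: (@le_trans _ _ (((x + a * 1) ^+ 2 + sqs c) / l ^+ 2 / 2 +
   ((x + a * -1) ^+ 2 + sqs c) / l ^+ 2 / 2)); first lra.
by rewrite le_eqVlt; apply/orP; left; apply/eqP; field; lra.
Qed.

End sign_averages.

(** * Integration of functions of finitely many Rademacher functions *)

Section dyadic_integrals.
Context {R : realType}.
Local Notation mu := (@lebesgue_measure R).
Implicit Types (m n j : nat) (H : seq R -> R) (t : R).

Lemma integral_split_itv (a b c : R) (f : R -> R) : a < b -> b < c ->
  (forall t, 0 <= f t) ->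
  measurable_fun (`]a, b[ : set R) f -> measurable_fun (`]b, c[ : set R) f ->
  measurable_fun (`]a, c[ : set R) f /\
  (\int[mu]_(t in `]a, c[) (f t)%:E =
   \int[mu]_(t in `]a, b[) (f t)%:E + \int[mu]_(t in `]b, c[) (f t)%:E)%E.
Proof.
move=> ab bc f0 mab mbc.
have U : (`]a, c[ : set R)%classic = `]a, b[%classic `|` `[b, c[%classic.
  by apply: itv_bndbnd_setU; rewrite bnd_simp// ltW.
have mbc' : measurable_fun (`[b, c[ : set R) f.
  exact/measurable_fun_itv_obnd_cbndP.
have mac : measurable_fun (`]a, c[ : set R) f.
  by rewrite U; apply/measurable_funU.
split=> //; rewrite {1}U ge0_integral_setU//.
- congr (_ + _)%E; apply: integral_itv_bndoo; exact/measurable_EFinP.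
- by rewrite -U; exact/measurable_EFinP.
- by move=> t _; rewrite lee_fin.
- apply/disj_set2P; rewrite -subset0 => t /= []; rewrite !in_itv/=.
  by move=> /andP[_ tb] /andP[bt _]; move: tb; rewrite ltNge bt.
Qed.

Definition dyadic m j : set R := `]j%:R / 2 ^+ m, j.+1%:R / 2 ^+ m[%classic.

(** On the j-th dyadic interval of length 2^-m the argument of the sine lies
    between j pi and (j + 1) pi. *)
Lemma rademacher_dyadic m j t : dyadic m j t -> rademacher m t = (-1) ^+ j.
Proof.
rewrite /dyadic /= in_itv/= ltr_pdivrMr ?exprn_gt0// ltr_pdivlMr ?exprn_gt0//.
move=> /andP[jt tj]; rewrite /rademacher.
set x := 2 ^+ m * pi * t - pi *+ j.
have -> : 2 ^+ m * pi * t = x + pi *+ j by rewrite subrK.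
rewrite (alternatingn (@sinDpi R)).
have pi0 := pi_gt0 R.
have x0 : 0 < x.
  have -> : x = (t * 2 ^+ m - j%:R) * pi by rewrite /x -mulr_natr; ring.
  by rewrite mulr_gt0// subr_gt0.
have xpi : x < pi.
  have -> : x = (t * 2 ^+ m - j%:R) * pi by rewrite /x -mulr_natr; ring.
  by rewrite -ltr_pdivlMr// divff ?gt_eqF//; move: tj; rewrite -natr1; lra.
have sx : 0 < sin x by apply: sin_gt0_pi; rewrite x0.
by rewrite sgrM (gtr0_sg sx) mulr1 sgrX sgrN1.
Qed.

Fixpoint rads m n t : seq R :=
  if n is n'.+1 then rademacher m.+1 t :: rads m.+1 n' t else [::].

Lemma rademacher_le1 k t : `|rademacher k t : R| <= 1.
Proof. by rewrite /rademacher normr_sg; case: (_ == _) => /=. Qed.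

Lemma rads_le1 m n t : all (fun e : R => `|e| <= 1) (rads m n t).
Proof. by elim: n m => //= n IH m; rewrite rademacher_le1 IH. Qed.

(** On a dyadic interval of order m the function r_(m+1) equals 1 on the left
    half and -1 on the right half, and the halves are dyadic of order m + 1:
    splitting the integral mirrors the recursion that defines [avg]. *)
Lemma integral_rads m n j H :
  (forall s, all (fun e => `|e| <= 1) s -> 0 <= H s) ->
  measurable_fun (dyadic m j) (fun t => H (rads m n t)) /\
  (\int[mu]_(t in dyadic m j) (H (rads m n t))%:E = (avg n H / 2 ^+ m)%:E)%E.
Proof.
elim: n m j H => [|n IH] m j H H0 /=.
  split; first exact: measurable_cst.
  rewrite /dyadic integral_cst//= lebesgue_measure_itv/= lte_fin.
  rewrite ltr_pM2r ?invr_gt0 ?exprn_gt0// ltr_nat ltnSn -EFinD -EFinM.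
  by rewrite -mulrBl -natrB// subSnn mul1r.
have d0 : (0 : R) < (2 ^+ m.+1)^-1 by rewrite invr_gt0 exprn_gt0.
have e2 (k : nat) : (k%:R / 2 ^+ m : R) = k.*2%:R / 2 ^+ m.+1.
  by rewrite exprS -muln2 natrM; field; rewrite expf_neq0.
have half (i : nat) : i = j.*2 \/ i = j.*2.+1 ->
    measurable_fun (dyadic m.+1 i)
      (fun t => H (rademacher m.+1 t :: rads m.+1 n t)) /\
    (\int[mu]_(t in dyadic m.+1 i)
       (H (rademacher m.+1 t :: rads m.+1 n t))%:E =
     (avg n (fun s => H ((-1) ^+ i :: s)) / 2 ^+ m.+1)%:E)%E.
  move=> _; have [|mf intf] := IH m.+1 i (fun s => H ((-1) ^+ i :: s)).
    by move=> s s1; apply: H0; rewrite /= normrX normrN1 expr1n lexx.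
  split.
    apply: eq_measurable_fun mf => t; rewrite inE => it /=.
    by rewrite (rademacher_dyadic it).
  rewrite -intf; apply: eq_integral => t; rewrite inE => it.
  by rewrite (rademacher_dyadic it).
have [m1 i1] := half _ (or_introl erefl).
have [m2 i2] := half _ (or_intror erefl).
have Ed : dyadic m j =
    `](j.*2)%:R / 2 ^+ m.+1, (j.*2.+2)%:R / 2 ^+ m.+1[%classic.
  by rewrite /dyadic !e2 doubleS.
rewrite Ed; have := @integral_split_itv _ (j.*2.+1%:R / 2 ^+ m.+1) _
  (fun t => H (rademacher m.+1 t :: rads m.+1 n t)) _ _ _ m1 m2.
case=> //.
- by rewrite ltr_pM2r// ltr_nat.
- by rewrite ltr_pM2r// ltr_nat.
- by move=> t; apply: H0; rewrite /= rademacher_le1 rads_le1.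
move=> mf ->; split=> //.
rewrite [X in (X + _)%E]i1 [X in (_ + X)%E]i2 -EFinD; congr (_%:E).
rewrite -[(-1) ^+ _.+1]signr_odd -[(-1) ^+ _.*2]signr_odd /= odd_double /=.
rewrite expr0 expr1 exprS; field; rewrite expf_neq0//.
Qed.

End dyadic_integrals.

(** * Almost everywhere convergence of Rademacher series *)

Section almost_everywhere_convergence.
Context {R : realType}.
Local Notation mu := (@lebesgue_measure R).
Local Notation D := (`[0, 1]%classic : set R).
Local Notation Do := (`]0, 1[%classic : set R).
Implicit Types (n m k : nat) (H : seq R -> R) (t : R) (a : nat -> R).

(** The first Rademacher function is constant on ]0, 1[, the dyadic interval
    of order 0, so it does not appear among the arguments of [H]. *)
Lemma integral01 n H (f : R -> R) :
  (forall s, all (fun e => `|e| <= 1) s -> 0 <= H s) ->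
  (forall t, Do t -> f t = H (rads 0 n t)) ->
  measurable_fun D f /\ (\int[mu]_(t in D) (f t)%:E = (avg n H)%:E)%E.
Proof.
move=> H0 fH; have [] := integral_rads 0 n 0 H0.
have -> : dyadic 0 0 = Do by rewrite /dyadic expr0 !divr1.
rewrite expr0 divr1 => mH iH.
have mf : measurable_fun Do f.
  by apply: eq_measurable_fun mH => t; rewrite inE => /fH.
split.
  exact/measurable_fun_itv_obnd_cbndP/measurable_fun_itv_bndo_bndcP.
rewrite integral_itv_bndoo; last exact/measurable_EFinP.
by rewrite -iH; apply: eq_integral => t; rewrite inE => /fH ->.
Qed.

Lemma measurable01 n H (f : R -> R) :
  (forall t, Do t -> f t = H (rads 0 n t)) -> measurable_fun D f.
Proof.
move=> fH.
have M0 (x : R) : 0 <= Num.max x 0 by rewrite le_max lexx orbT.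
have [|m1 _] := @integral01 n (fun s => Num.max (H s) 0)
  (fun t => Num.max (f t) 0) (fun s _ => M0 _); first by move=> t /fH ->.
have [|m2 _] := @integral01 n (fun s => Num.max (- H s) 0)
  (fun t => Num.max (- f t) 0) (fun s _ => M0 _); first by move=> t /fH ->.
have -> : f = (fun t => Num.max (f t) 0) \- (fun t => Num.max (- f t) 0).
  by apply/funext => t /=; rewrite /Num.max; case: ifP; case: ifP; lra.
exact: measurable_funB.
Qed.

Definition psum a n t : R := series (fun k => a k * rademacher k t) n.

Lemma psumE a n t : psum a n t = \sum_(0 <= k < n) a k * rademacher k t.
Proof. by []. Qed.

(** The coefficients of the random signs: that of r_0 = 1 is left out. *)
Definition coefs a n : seq R := mkseq (fun i => a i.+1) n.

Lemma lin_rads m a n t : lin (mkseq (fun i => a (m + i).+1) n) (rads m n t) =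
  \sum_(0 <= i < n) a (m + i).+1 * rademacher (m + i).+1 t.
Proof.
elim: n m => [|n IH] m; first by rewrite /lin big_nil big_geq.
have -> : mkseq (fun i => a (m + i).+1) n.+1 =
    a m.+1 :: mkseq (fun i => a (m.+1 + i).+1) n.
  rewrite /mkseq /= addn0 -[1%N]addn0 iotaDl -map_comp; congr (_ :: _).
  by apply: eq_map => i /=; rewrite add1n addSnnS.
rewrite /= lin_cons IH big_nat_recl//= addn0; congr (_ + _).
by apply: eq_bigr => i _; rewrite addSnnS.
Qed.

Lemma psum_lin a n t : Do t ->
  psum a n.+1 t = a 0 + lin (coefs a n) (rads 0 n t).
Proof.
move=> t01; rewrite psumE big_nat_recl// (@rademacher_dyadic _ 0 0) ?mulr1.
  by rewrite (lin_rads 0).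
by rewrite /dyadic expr0 !divr1.
Qed.

Lemma take_rads m n k t : (k <= n)%N -> take k (rads m n t) = rads m k t.
Proof.
by elim: k m n => [|k IH] m [|n]//= kn; rewrite ?take0// IH.
Qed.

Lemma take_coefs a n k : (k <= n)%N -> take k (coefs a n) = coefs a k.
Proof.
by move=> kn; rewrite /coefs /mkseq -map_take take_iota (minn_idPl kn).
Qed.

Lemma lin_take (c s : seq R) k : size c = k -> lin c s = lin c (take k s).
Proof.
by move=> <-; rewrite /lin; elim: c s => [|x c IH] [|e s]//=; rewrite !big_cons IH.
Qed.

Lemma sqs_coefs a n : sqs (coefs a n) = \sum_(0 <= k < n) a k.+1 ^+ 2.
Proof. by rewrite /sqs /coefs /mkseq big_map /index_iota subn0. Qed.

Lemma measurable_psum a n : measurable_fun D (psum a n).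
Proof.
case: n => [|n].
  have -> : psum a 0 = cst 0.
    by apply/funext => t; rewrite psumE big_geq.
  exact: measurable_cst.
by apply: (@measurable01 n (fun s => a 0 + lin (coefs a n) s)) => t /psum_lin.
Qed.

(** The set of t at which some partial sum of index at most n is large has
    measure at most V / l^2 by [avg_hit]; these sets increase with n.  The
    coefficient of r_0 vanishes so that the walk starts at 0. *)
Lemma kolmogorov_maximal a (V l : R) : a 0 = 0 -> 0 < l ->
  (forall n, \sum_(0 <= k < n) a k ^+ 2 <= V) ->
  exists2 N : set R, measurable N /\ (mu N <= (V / l ^+ 2)%:E)%E &
    forall t k, Do t -> l <= `|psum a k t| -> N t.
Proof.
move=> a0 l0 aV.
pose P n t := [exists k : 'I_n.+1, l <= `|psum a k.+1 t|].
pose F n : set R := [set t | Do t /\ P n t].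
have mP n : measurable_fun D (fun t => (P n t)%:R : R) /\
    (\int[mu]_(t in D) ((P n t)%:R : R)%:E <= (V / l ^+ 2)%:E)%E.
  pose Hn s : R :=
    [exists k : 'I_n.+1, l <= `|lin (take k (coefs a n)) s|]%:R.
  have [|m1 ->] := @integral01 n Hn (fun t => (P n t)%:R) (fun s _ => ler0n _ _).
    move=> t t01; rewrite /Hn /P; congr (nat_of_bool _)%:R.
    apply: eq_existsb => k; rewrite psum_lin// a0 add0r take_coefs ?leq_ord//.
    by rewrite [in RHS](@lin_take _ _ k) ?size_mkseq// take_rads ?leq_ord.
  split=> //; rewrite lee_fin -[n in avg n](size_mkseq (fun i => a i.+1)).
  apply: (@le_trans _ _ (avg (size (coefs a n))
      (fun s => (hit l 0 (coefs a n) s)%:R))).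
    apply: avg_le => s; rewrite /Hn ler_nat.
    case: existsP => [[k lk]|_]//.
    by rewrite (@hit_take _ _ _ _ _ k) ?add0r.
  apply: le_trans (avg_hit _ _ l0) _.
  rewrite expr0n/= add0r ler_pM2r ?invr_gt0 ?exprn_gt0// sqs_coefs.
  by have := aV n.+1; rewrite big_nat_recl// a0 expr0n/= add0r.
have FE n : F n = D `&` (fun t => (P n t)%:R : R) @^-1` [set 1] `&` Do.
  apply/seteqP; split => t /=.
    move=> [t01 ->]; split=> //; split => //.
    by move: t01; rewrite !in_itv/= => /andP[/ltW-> /ltW->].
  move=> [[_ Pt] t01]; split => //; case: (P n t) Pt => //= /eqP.
  by rewrite eq_sym oner_eq0.
have mF n : measurable (F n).
  by rewrite FE; apply: measurableI => //; apply: (mP n).1.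
have muF n : (mu (F n) <= (V / l ^+ 2)%:E)%E.
  have <- : (\int[mu]_(t in F n) ((P n t)%:R : R)%:E = mu (F n))%E.
    rewrite -[RHS]mul1e -integral_cst; last exact: mF.
    apply: eq_integral => t.
    by rewrite inE => -[_ ->].
  apply: le_trans (mP n).2; apply: ge0_subset_integral => //.
  - exact: mF.
  - by apply/measurable_EFinP; exact: (mP n).1.
  - by rewrite FE => t [[]].
have mU : measurable (\bigcup_n F n) by exact: bigcup_measurable.
exists (\bigcup_n F n); [split=> //|].
  have ndF : {homo F : n m / (n <= m)%N >-> (n <= m)%O}.
    move=> n m nm; apply/subsetPset => t [t01 /existsP[k lk]]; split=> //.
    apply/existsP; have km : (k < m.+1)%N by exact: leq_trans (ltn_ord k) _.
    by exists (Ordinal km).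
  have c := nondecreasing_cvg_mu (mu := mu) mF mU ndF.
  rewrite -(cvg_lim _ c)//; apply: lime_le; first by apply/cvg_ex; eexists; exact: c.
  by apply: nearW => n; exact: muF.
move=> t [|k] t01.
  by rewrite psumE big_geq// normr0 leNgt l0.
by move=> lk; exists k => //; split => //; apply/existsP; exists ord_max.
Qed.

Definition tail m a k : R := if (k < m)%N then 0 else a k.

(** Choose m so that the m-th partial sum is within e of the supremum. *)
Lemma sum_tail_small (u : nat -> R) (V e : R) : (forall k, 0 <= u k) ->
  (forall n, \sum_(0 <= k < n) u k <= V) -> 0 < e ->
  exists m, forall n, \sum_(0 <= k < n) tail m u k <= e.
Proof.
move=> u0 uV e0.
pose S := [set \sum_(0 <= k < n) u k | n in [set: nat]].
have hS : has_sup S.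
  split; first by exists (\sum_(0 <= k < 0) u k); exists 0.
  by exists V => _ [n _ <-]; exact: uV.
have [_ [m _ <-] hm] := sup_adherent e0 hS.
exists m => n.
have le_max : (n <= maxn m n)%N by rewrite leq_maxr.
apply: (@le_trans _ _ (\sum_(0 <= k < maxn m n) tail m u k)).
  rewrite [leRHS](@big_cat_nat _ _ _ n)//= lerDl sumr_ge0// => k _.
  by rewrite /tail; case: ifP.
rewrite (@big_cat_nat _ _ _ m)//= ?leq_maxl// big_nat_cond big1 ?add0r; last first.
  by move=> k; rewrite andbT /tail => /andP[_ ->].
have hM : \sum_(0 <= k < maxn m n) u k <= sup S.
  by apply: sup_upper_bound => //; exists (maxn m n).
rewrite (@big_cat_nat _ _ _ m)//= ?leq_maxl// in hM.
rewrite big_nat_cond (eq_bigr u) -?big_nat_cond; last first.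
  by move=> k /andP[/andP[mk _] _]; rewrite /tail ltnNge mk.
lra.
Qed.

Definition l2_le a (B : R) := forall n, \sum_(0 <= k < n) a k ^+ 2 <= B.

Lemma psum_sub a m n t : (m <= n)%N -> psum a n t - psum a m t =
  psum (tail m a) n t.
Proof.
move=> mn; rewrite !psumE [\sum_(0 <= k < n) a k * _](@big_cat_nat _ _ _ m)//=.
rewrite addrAC subrr add0r [RHS](@big_cat_nat _ _ _ m)//=.
rewrite [X in _ = X + _]big_nat_cond [X in _ = X + _]big1 ?add0r; last first.
  by move=> k; rewrite andbT /tail => /andP[_ ->]; rewrite mul0r.
by apply: eq_big_nat => k /andP[mk _]; rewrite /tail ltnNge mk.
Qed.

(** Applying the maximal inequality to the tails gives, for each threshold
    1 / (j + 1) and each i, an index m beyond which the partial sums move by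
    less than the threshold outside a set of measure at most 1 / (i + 1).
    Intersecting over i leaves a null set for each j, off which the partial
    sums form a Cauchy sequence. *)
Lemma psum_cvg_ae a B : l2_le a B ->
  {ae mu, forall t, D t -> cvgn (fun n => psum a n t)}.
Proof.
move=> aB.
have good (j i : nat) : exists m, exists2 N : set R,
    measurable N /\ (mu N <= (i.+1%:R^-1)%:E)%E &
    forall t k, Do t -> (m <= k)%N ->
      j.+1%:R^-1 <= `|psum a k t - psum a m t| -> N t.
  have j0 : 0 < j.+1%:R^-1 :> R by rewrite invr_gt0.
  have i0 : 0 < i.+1%:R^-1 * j.+1%:R^-1 ^+ 2 :> R.
    by rewrite mulr_gt0 ?invr_gt0 ?exprn_gt0 ?invr_gt0.
  have [m hm] := sum_tail_small (fun k => sqr_ge0 (a k)) aB i0.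
  pose b := tail m.+1 a.
  have bV n : \sum_(0 <= k < n) b k ^+ 2 <= i.+1%:R^-1 * j.+1%:R^-1 ^+ 2.
    apply: le_trans (hm n); apply: ler_sum => k _; rewrite /b /tail ltnS.
    case: (ltngtP k m) => km; rewrite ?expr0n//= ?sqr_ge0//.
  have [N [mN muN] hN] := @kolmogorov_maximal b _ _ erefl j0 bV.
  exists m.+1, N; first split=> //.
    by apply: le_trans muN _; rewrite lee_fin mulfK// expf_neq0// gt_eqF.
  by move=> t k t01 mk; rewrite psum_sub//; exact: hN.
have {}good (ji : nat * nat) : exists mN : nat * set R,
    [/\ measurable mN.2, (mu mN.2 <= (ji.2.+1%:R^-1)%:E)%E &
    forall t k, Do t -> (mN.1 <= k)%N ->
      ji.1.+1%:R^-1 <= `|psum a k t - psum a mN.1 t| -> mN.2 t].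
  by have [m [N [? ?] ?]] := good ji.1 ji.2; exists (m, N).
have [g hg] := choice good.
pose M j := \bigcap_i (g (j, i)).2.
have mM j : measurable (M j).
  apply: bigcap_measurable => [|i _]; first by exists 0.
  by have [] := hg (j, i).
have M0 j : mu (M j) = 0.
  apply/eqP; rewrite eq_le measure_ge0 andbT.
  apply/lee_addgt0Pr => e e0; rewrite add0e.
  have [i _ hi] : exists2 i : nat, True & i.+1%:R^-1 < e.
    by have [i] := ltr_add_invr e0; rewrite add0r => hi; exists i.
  have [mN muN _] := hg (j, i).
  apply: (@le_trans _ _ (mu (g (j, i)).2)).
    apply: le_measure; rewrite ?inE//; first exact: mM.
    by move=> t; apply.
  by apply: le_trans muN _; rewrite lee_fin ltW.
have neg : mu.-negligible (\bigcup_j M j `|` [set 0] `|` [set 1]).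
  apply: negligibleU; first apply: negligibleU.
  - by apply: negligible_bigcup => j; apply/negligibleP; [exact: mM|exact: M0].
  - by apply/negligibleP; [exact: measurable_set1|exact: lebesgue_measure_set1].
  - by apply/negligibleP; [exact: measurable_set1|exact: lebesgue_measure_set1].
apply: negligibleS neg => t /= /not_implyP [t01 ncv].
have [->|t0] := eqVneq t 0; first by left; right.
have [->|t1] := eqVneq t 1; first by right.
left; left; apply: contrapT => nM; apply: ncv.
have {}t01 : Do t.
  move: t01; rewrite /= !in_itv/= => /andP[? ?].
  by rewrite !lt_neqAle eq_sym t0 t1; apply/andP.
apply: cauchy_cvg; apply/cauchy_exP => e e0.
have [j hj] := ltr_add_invr e0; rewrite add0r in hj.
have [i nN] : exists i, ~ (g (j, i)).2 t.
  apply: contrapT => /forallNP allN; apply: nM; exists j => // i _.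
  by apply: contrapT; exact: allN.
have [_ _ hN] := hg (j, i).
exists (psum a (g (j, i)).1 t); exists (g (j, i)).1 => // k /= mk.
rewrite /ball /= distrC ltNge; apply/negP => le; apply: nN.
by apply: (hN _ k) => //; apply: le_trans le; exact: ltW.
Qed.

End almost_everywhere_convergence.

(** * Exponential integrability *)

Section exponential_integrability.
Context {R : realType}.
Local Notation mu := (@lebesgue_measure R).
Local Notation D := (`[0, 1]%classic : set R).
Local Notation Do := (`]0, 1[%classic : set R).
Implicit Types (n m k : nat) (t : R) (a b : nat -> R) (f g : R -> R).

Let aeF : Filter (nbhs (almost_everywhere mu)) :=
  ae_filter_ringOfSetsType mu.

Lemma ae01_imply (P Q : R -> Prop) : (forall t, D t -> P t -> Q t) ->
  {ae mu, forall t, D t -> P t} -> {ae mu, forall t, D t -> Q t}.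
Proof.
by move=> PQ; apply: (@filterS _ _ aeF) => t Pt Dt; exact: PQ (Pt Dt).
Qed.

Lemma ae01_and (P Q : R -> Prop) : {ae mu, forall t, D t -> P t} ->
  {ae mu, forall t, D t -> Q t} -> {ae mu, forall t, D t -> P t /\ Q t}.
Proof.
apply: (@filterS2 _ _ aeF) => t Pt Qt Dt.
by split; [exact: Pt|exact: Qt].
Qed.

Lemma psum_rsum_ae a B : l2_le a B ->
  {ae mu, forall t, D t -> psum a n t @[n --> \oo] --> rsum a t}.
Proof. by move=> /psum_cvg_ae; apply: ae01_imply. Qed.

Lemma le_exp_sqr (x : R) : x <= expR (x ^+ 2).
Proof. by have := expR_ge1Dx (x ^+ 2); nra. Qed.

Lemma measurable_exp_sqr f (u : R) : meas01 f ->
  measurable_fun D (fun t => expR ((f t / u) ^+ 2)).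
Proof.
move=> mf; apply: measurableT_comp; first exact: measurable_expR.
by apply: measurable_funX; exact: measurable_funM.
Qed.

(** It converts the condition in the norm of L_N into a bound by 2 on the
    integral of the exponential itself. *)
Lemma integral_expsq f (u : R) : meas01 f ->
  (\int[mu]_(t in D) (expR ((f t / u) ^+ 2))%:E =
   \int[mu]_(t in D) (expsq (`|f t| / u))%:E + 1)%E.
Proof.
move=> mf.
have sqE t : (`|f t| / u) ^+ 2 = (f t / u) ^+ 2.
  by rewrite !exprMn real_normK ?num_real.
have muD : mu D = 1%E.
  by rewrite lebesgue_measure_itv/= lte_fin ltr01 sube0.
have e1 : (\int[mu]_(t in D) cst 1 t = 1 :> \bar R)%E.
  by rewrite integral_cst// mul1e; exact: muD.
rewrite -[in X in (_ + X)%E]e1 -ge0_integralD//.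
- by apply: eq_integral => t _; rewrite /expsq sqE -EFinD subrK.
- move=> t _; rewrite lee_fin /expsq subr_ge0 -expR0 ler_expR.
  by rewrite sqE sqr_ge0.
- apply/measurable_EFinP; apply: measurable_funB => //.
  apply: eq_measurable_fun (measurable_exp_sqr u mf) => t _.
  by rewrite sqE.
Qed.

(** This is [avg_expR_sqr] with al = 1 / u^2 and x = a_0: the parameter
    al / (1 - 8 al s) is then at most 2 al, and the exponent at most 1/2. *)
Lemma integral_exp_psum a n (u : R) : 0 < u ->
  16 * \sum_(0 <= k < n.+1) a k ^+ 2 <= u ^+ 2 ->
  (\int[mu]_(t in D) (expR ((psum a n.+1 t / u) ^+ 2))%:E <= 2%:E)%E.
Proof.
move=> u0 au.
have u2 : 0 < u ^+ 2 by rewrite exprn_gt0.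
pose H s := expR ((u ^+ 2)^-1 * (a 0 + lin (coefs a n) s) ^+ 2).
have [||_ ->] := @integral01 _ n H (fun t => expR ((psum a n.+1 t / u) ^+ 2)).
- by move=> s _; exact: expR_ge0.
- by move=> t t01; rewrite psum_lin// /H exprMn exprVn mulrC.
rewrite lee_fin -{1}[n](size_mkseq (fun i => a i.+1)) -/(coefs a n).
rewrite big_nat_recl// -sqs_coefs in au.
have a02 := sqr_ge0 (a 0); have s0 := sqs_ge0 (coefs a n).
set s := sqs _ in au s0 *.
have al0 : 0 <= (u ^+ 2)^-1 by rewrite invr_ge0 ltW.
have alu : (u ^+ 2)^-1 * u ^+ 2 = 1 by rewrite mulVf ?gt_eqF.
set al := (u ^+ 2)^-1 in al0 alu *.
have als : 16 * (al * (a 0 ^+ 2 + s)) <= 1.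
  by rewrite mulrCA -[leRHS]alu ler_wpM2l.
have als0 : 0 <= al * s by rewrite mulr_ge0.
have ala0 : 0 <= al * a 0 ^+ 2 by rewrite mulr_ge0.
have lt1 : 8 * al * s < 1 by rewrite -mulrA; lra.
apply: le_trans (avg_expR_sqr _ al0 lt1) _.
apply: (@le_trans _ _ (expR 2^-1)); last first.
  have h2 : 2^-1 < 1 :> R by lra.
  apply: le_trans (expR_leV h2) _.
  have -> : (1 - 2^-1)^-1 = 2 :> R by field.
  exact: lexx.
rewrite ler_expR -/s mulrAC ler_pdivrMr; last lra.
rewrite -[8 * al * s]mulrA; lra.
Qed.

Lemma limn_einf_le (v : (\bar R)^nat) (x : \bar R) :
  (forall n, (v n <= x)%E) -> (limn_einf v <= x)%E.
Proof.
move=> vx; rewrite limn_einf_lim; apply: lime_le; first exact: is_cvg_einfs.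
apply: nearW => n; apply: le_trans (vx n); apply: ereal_inf_lbound.
by exists n => /=.
Qed.

Lemma measurable_limn_einf (v : (R -> \bar R)^nat) :
  (forall n, measurable_fun D (v n)) ->
  measurable_fun D (fun t => limn_einf (v ^~ t)).
Proof.
move=> mv.
have -> : (fun t => limn_einf (v ^~ t)) =
    (fun t => - limn_esup (fun n => - v n t))%E.
  by apply/funext => t; rewrite -[LHS]oppeK -limn_esupN.
apply: measurableT_comp => //; apply: measurable_fun_limn_esup => n.
exact: measurableT_comp.
Qed.

(** Fatou along the partial sums. *)
Lemma integral_exp_rsum a f (B u : R) : l2_le a B -> 0 < u -> 16 * B <= u ^+ 2 ->
  meas01 f -> ae01 f (rsum a) ->
  (\int[mu]_(t in D) (expR ((f t / u) ^+ 2))%:E <= 2%:E)%E.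
Proof.
move=> aB u0 Bu mf fa.
pose F n t := (expR ((psum a n.+1 t / u) ^+ 2))%:E.
have mF n : measurable_fun D (F n).
  apply/measurable_EFinP; apply: measurable_exp_sqr; exact: measurable_psum.
have F0 n t : D t -> (0 <= F n t)%E by move=> _; rewrite lee_fin expR_ge0.
have h1 : (limn_einf (fun n => \int[mu]_(t in D) F n t) <= 2%:E)%E.
  apply: limn_einf_le => n; apply: integral_exp_psum => //.
  by apply: le_trans Bu; rewrite ler_pM2l.
apply: le_trans h1; apply: le_trans (fatou mu (measurable_itv _) mF F0).
apply: ae_ge0_le_integral => //.
- by apply/measurable_EFinP; exact: measurable_exp_sqr.
- move=> t Dt; rewrite limn_einf_lim; apply: lime_ge; first exact: is_cvg_einfs.
  by apply: nearW => n; apply: le_ereal_inf_tmp => _ [k _ <-]; exact: F0.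
- exact: measurable_limn_einf.
apply: (ae01_imply _ (ae01_and fa (psum_rsum_ae aB))) => t Dt [-> cv].
have c : F ^~ t @ \oo --> (expR ((rsum a t / u) ^+ 2))%:E.
  apply: cvg_EFin; first exact: nearW.
  apply: (@continuous_cvg _ _ _ _ _ _ expR); first exact: continuous_expR.
  apply: cvgM; apply: cvgMl; by rewrite cvg_shiftS.
by rewrite (cvg_limn_einf_sup c).1.
Qed.

(** The upper limit of the partial sums is measurable and agrees with the sum
    wherever the series converges. *)
Lemma rsum_measurable_rep a B : l2_le a B ->
  exists2 f, meas01 f & ae01 f (rsum a).
Proof.
move=> aB.
exists (fun t => fine (limn_esup (fun n => (psum a n t)%:E))).
  apply: measurableT_comp => //; apply: measurable_fun_limn_esup => n.
  by apply/measurable_EFinP; exact: measurable_psum.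
apply: (ae01_imply _ (psum_rsum_ae aB)) => t Dt cv.
have c : (psum a n t)%:E @[n --> \oo] --> (rsum a t)%:E.
  by apply: cvg_EFin; [exact: nearW|exact: cv].
by rewrite (cvg_limn_einf_sup c).2.
Qed.

(** If s <= 2 tau the first term suffices.  Otherwise the inequality of the
    arithmetic and geometric means bounds s g by half of
    s^2 exp (tau^2) + g^2 exp (- tau^2), and tau^2 < s^2 / 4 lets exp (s^2)
    absorb s^2 exp (tau^2). *)
Lemma young_exp (s g tau : R) : 0 <= s -> 0 <= g -> 0 <= tau ->
  s * g <= 2 * tau * g + 2^-1 * expR (- tau ^+ 2) * g ^+ 2 + expR (s ^+ 2).
Proof.
move=> s0 g0 tau0.
have q0 := expR_gt0 (- tau ^+ 2); have e0 := expR_gt0 (s ^+ 2).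
have gg := sqr_ge0 g.
have [st|ts] := leP s (2 * tau); first by nra.
have p0 := expR_gt0 (tau ^+ 2).
have pq : expR (- tau ^+ 2) * expR (tau ^+ 2) = 1.
  by rewrite -expRD addrC subrr expR0.
have h : s ^+ 2 * expR (tau ^+ 2) <= 2 * expR (s ^+ 2).
  have h1 := expR_ge1Dx (s ^+ 2 / 2).
  have -> : expR (s ^+ 2) = expR (s ^+ 2 / 2) * expR (s ^+ 2 / 2).
    by rewrite -expRD; congr expR; field.
  have h2 : expR (tau ^+ 2) <= expR (s ^+ 2 / 2) by rewrite ler_expR; nra.
  by rewrite mulrA; apply: ler_pM => //; [exact: sqr_ge0|lra].
set p := expR (tau ^+ 2) in p0 pq h; set q := expR _ in q0 pq *.
have : 0 <= q * (s * p - g) ^+ 2 by rewrite mulr_ge0 ?sqr_ge0// ltW.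
have -> : q * (s * p - g) ^+ 2 =
  (q * p) * (s ^+ 2 * p) - 2 * (q * p) * s * g + q * g ^+ 2 by ring.
rewrite pq; nra.
Qed.

(** The upper bound involves only the nonzero entries of [b], so it does not
    grow when [b] is padded by zeros. *)
Lemma riesz_bounds (b s : seq R) : all (fun x => `|x| <= 1) b ->
  all (fun x => `|x| <= 1) s ->
  0 <= riesz b s <= expR (\sum_(x <- b) `|x|).
Proof.
elim: b s => [|x b IH] s.
  by case: s => [|? ?] _ _; rewrite /riesz /= !big_nil expR0 ler01 lexx.
case: s => [|e s] /=.
  move=> _ _; rewrite /riesz big_nil ler01 -expR0 ler_expR.
  by apply: sumr_ge0 => ? _.
move=> /andP[x1 b1] /andP[e1 s1]; have /andP[r0 rE] := IH s b1 s1.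
have xe : `|x * e| <= `|x| by rewrite normrM ler_piMr.
have := le_trans xe x1; rewrite ler_norml => /andP[xe1 _].
rewrite riesz_cons mulr_ge0//=; last by lra.
rewrite big_cons expRD ler_pM//; first by lra.
have := expR_ge1Dx `|x|; have := ler_norm (x * e); lra.
Qed.

End exponential_integrability.

(** * Testing a Rademacher series against a Riesz product *)

Section riesz_products.
Context {R : realType}.
Local Notation mu := (@lebesgue_measure R).
Local Notation D := (`[0, 1]%classic : set R).
Local Notation Do := (`]0, 1[%classic : set R).
Implicit Types (n m k : nat) (t : R) (a b : nat -> R) (f g : R -> R).

Lemma rsum_tail a B m : l2_le a B ->
  {ae mu, forall t, D t -> rsum (tail m a) t = rsum a t - psum a m t}.
Proof.
move=> aB; apply: (ae01_imply _ (psum_rsum_ae aB)) => t _ cv.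
apply: cvg_lim => //; rewrite -/(psum (tail m a)).
have cv' : psum a n t - psum a m t @[n --> \oo] --> rsum a t - psum a m t.
  by apply: cvgB => //; exact: cvg_cst.
apply: cvg_trans cv'; apply: near_eq_cvg.
by exists m => // n /= mn; rewrite psum_sub.
Qed.

Lemma rsum_lin a b (c A B : R) : l2_le a A -> l2_le b B ->
  {ae mu, forall t, D t ->
    rsum (fun k => c * a k + b k) t = c * rsum a t + rsum b t}.
Proof.
move=> aA bB.
apply: (ae01_imply _ (ae01_and (psum_rsum_ae aA) (psum_rsum_ae bB))) => t _ [ca cb].
apply: cvg_lim => //; rewrite -/(psum (fun k => c * a k + b k)).
have cv' : c * psum a n t + psum b n t @[n --> \oo] --> c * rsum a t + rsum b t.
  by apply: cvgD => //; exact: cvgMr.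
apply: cvg_trans cv'; apply: near_eq_cvg; apply: nearW => n.
rewrite !psumE mulr_sumr -big_split; apply: eq_bigr => k _ /=.
by rewrite mulrDl mulrA.
Qed.

Lemma l2_tail_small a (B e : R) : l2_le a B -> 0 < e ->
  exists m, forall m', (m <= m')%N -> l2_le (tail m' a) e.
Proof.
move=> aB e0; have [m hm] := sum_tail_small (fun k => sqr_ge0 (a k)) aB e0.
exists m => m' mm' n; apply: le_trans (hm n); apply: ler_sum => k _.
rewrite /tail; case: ltnP => [km'|km'].
  by rewrite expr0n/=; case: ifP => // _; exact: sqr_ge0.
by rewrite ltnNge (leq_trans mm' km').
Qed.

Lemma integral_lincomb_le (c d A B : R) f g : 0 <= c -> 0 <= d ->
  (forall t, 0 <= f t) -> (forall t, 0 <= g t) ->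
  measurable_fun D f -> measurable_fun D g ->
  (\int[mu]_(t in D) (f t)%:E <= A%:E)%E ->
  (\int[mu]_(t in D) (g t)%:E <= B%:E)%E ->
  [/\ forall t, 0 <= c * f t + d * g t,
    measurable_fun D (fun t => c * f t + d * g t) &
    (\int[mu]_(t in D) (c * f t + d * g t)%:E <= (c * A + d * B)%:E)%E].
Proof.
move=> c0 d0 f0 g0 mf mg fA gB.
have mcf : measurable_fun D (fun t => c * f t) by exact: measurable_funM.
have mdg : measurable_fun D (fun t => d * g t) by exact: measurable_funM.
split.
- by move=> t; rewrite addr_ge0// mulr_ge0.
- exact: measurable_funD.
under eq_integral do rewrite EFinD !EFinM.
rewrite ge0_integralD//.
- rewrite EFinD !EFinM; apply: leeD.
    rewrite ge0_integralZl//; last by move=> t _; rewrite lee_fin.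
      by apply: lee_wpmul2l => //; rewrite lee_fin.
    exact/measurable_EFinP.
  rewrite ge0_integralZl//; last by move=> t _; rewrite lee_fin.
    by apply: lee_wpmul2l => //; rewrite lee_fin.
  exact/measurable_EFinP.
- by move=> t _; rewrite -EFinM lee_fin mulr_ge0.
- exact/measurable_EFinP.
- by move=> t _; rewrite -EFinM lee_fin mulr_ge0.
- exact/measurable_EFinP.
Qed.

Lemma lin_coefs a b n : lin (coefs a n) (coefs b n) =
  \sum_(0 <= k < n) a k.+1 * b k.+1.
Proof. by rewrite /lin /coefs /mkseq zip_map big_map /index_iota subn0. Qed.

Lemma lin_le (c s : seq R) : all (fun x => `|x| <= 1) s ->
  `|lin c s| <= \sum_(x <- c) `|x|.
Proof.
elim: c s => [|x c IH] [|e s] /=; rewrite /lin /= ?big_nil ?normr0//.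
  by move=> _; exact: sumr_ge0.
move=> /andP[e1 /IH h]; rewrite !big_cons /=.
by apply: le_trans (ler_normD _ _) (lerD _ h); rewrite normrM ler_piMr.
Qed.

(** Integrate the decomposition against the Riesz product [G] of [e * b],
    where [e] is the sign of [a 0].  The function [G] has mean 1, that is,
    coefficient 1 on r_0 where [b 0] would be wanted; after multiplication by
    [e] the constant term contributes |a_0| >= a_0 b_0, and the other terms are
    unchanged as e^2 = 1.  The series is replaced by a partial sum, and the
    error [w] is negligible because it is exponentially integrable at an
    arbitrarily small scale [del]. *)
Lemma dual_pairing_le a b (B A u tau : R) (x0 x1 : R -> R) n :
  l2_le a B -> meas01 x0 -> meas01 x1 -> 0 <= A ->
  {ae mu, forall t, D t -> `|x0 t| <= A} ->
  0 < u -> (\int[mu]_(t in D) (expR ((x1 t / u) ^+ 2))%:E <= 2%:E)%E ->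
  ae01 (fun t => x0 t + x1 t) (rsum a) ->
  1 <= tau -> (forall k, `|b k| <= 1) -> l2_le b (tau ^+ 2) ->
  \sum_(0 <= k < n.+1) a k * b k <= A + 5 * tau * u.
Proof.
move=> aB m0 m1 A0 x0A u0 ex1 xa tau1 b1 btau.
apply/ler_addgt0Pr => eps eps0.
pose L : R := expR n%:R.
have L0 : 0 < L by exact: expR_gt0.
pose del := eps / (2 * L).
have del0 : 0 < del by rewrite divr_gt0// mulr_gt0.
have v0 : 0 < del ^+ 2 / 16 by rewrite divr_gt0// exprn_gt0.
have [m hm] := l2_tail_small aB v0.
pose M := maxn m n.
have tM : l2_le (tail M.+1 a) (del ^+ 2 / 16).
  by apply: hm; rewrite leqW// leq_maxl.
pose e : R := if 0 <= a 0 then 1 else -1.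
have ee : e * e = 1 by rewrite /e; case: ifP => _; rewrite ?mulr1// mulrNN mulr1.
have ea : e * a 0 = `|a 0|.
  rewrite /e; case: (leP 0 (a 0)) => h; first by rewrite mul1r ger0_norm.
  by rewrite mulN1r ltr0_norm.
have e1 : `|e| = 1 by rewrite /e; case: ifP => _; rewrite ?normrN normr1.
(* L bounds G.  As del depends on L and M on del, the bound L must not involve M,
   hence the padding of b by zeros beyond n. *)
pose b' k := if (k <= n)%N then e * b k else 0.
pose bs := coefs b' M; pose as' := coefs (fun k => e * a k) M.
pose G t := riesz bs (rads 0 M t).
have bs1 : all (fun x => `|x| <= 1) bs.
  apply/allP => x /mapP[k _ ->]; rewrite /b'; case: ifP => _.
    by rewrite normrM e1 mul1r.
  by rewrite normr0.
have sumbs : \sum_(x <- bs) `|x| <= n%:R.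
  rewrite /bs /coefs /mkseq big_map -[M in iota 0 M]subn0 -/(index_iota 0 M).
  have nM : (n <= M)%N by rewrite leq_maxr.
  rewrite (big_cat_nat (n := n))//= [X in _ + X]big_nat_cond [X in _ + X]big1.
    rewrite addr0; apply: (@le_trans _ _ (\sum_(0 <= k < n) (1 : R))).
      apply: ler_sum => k _; rewrite /b'; case: ifP => _.
        by rewrite normrM e1 mul1r.
      by rewrite normr0.
    by rewrite sumr_const_nat subn0.
  move=> k /andP[/andP[nk _] _]; rewrite /b' ifF ?normr0//.
  by rewrite leqNgt ltnS nk.
have G0L t : 0 <= G t <= L.
  have /andP[g0 gE] := riesz_bounds bs1 (rads_le1 0 M t).
  by rewrite g0 (le_trans gE)// ler_expR.
have szb : size bs = M by rewrite size_mkseq.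
(* Adding M1 makes the integrand nonnegative, so that its integral is an average
   over signs and grows with the integrand. *)
pose M1 := \sum_(0 <= k < M.+1) `|a k|.
have M10 : 0 <= M1 by apply: sumr_ge0.
have psM t : `|e * psum a M.+1 t| <= M1.
  rewrite normrM e1 mul1r psumE; apply: le_trans (ler_norm_sum _ _ _) _.
  apply: ler_sum => k _; rewrite normrM ler_piMr//; exact: rademacher_le1.
have mG2 : avg M (riesz bs) = 1 by rewrite -{1}szb avg_riesz.
have [mG iG] : measurable_fun D G /\ (\int[mu]_(t in D) (G t)%:E = 1)%E.
  have [|mG iG] := @integral01 _ M (riesz bs) G _ (fun t _ => erefl).
    by move=> s s1; have /andP[] := riesz_bounds bs1 s1.
  by split=> //; rewrite iG mG2.
have iG2 : (\int[mu]_(t in D) (G t ^+ 2)%:E <= (expR (tau ^+ 2))%:E)%E.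
  have [|_ ->] := @integral01 _ M (fun s => riesz bs s ^+ 2) (fun t => G t ^+ 2) _
    (fun t _ => erefl); first by move=> s _; exact: sqr_ge0.
  rewrite lee_fin -{1}szb; apply: le_trans (avg_riesz_sqr _) _.
  rewrite ler_expR sqs_coefs; apply: le_trans (btau M.+1).
  rewrite big_nat_recl//; apply: (@le_trans _ _ (\sum_(0 <= k < M) b k.+1 ^+ 2)).
    apply: ler_sum => k _; rewrite /b'; case: ifP => _.
      by rewrite exprMn expr2 ee mul1r.
    by rewrite expr0n/= sqr_ge0.
  by rewrite lerDr sqr_ge0.
have M1E : M1 = `|e * a 0| + \sum_(x <- as') `|x|.
  rewrite /M1 big_nat_recl// normrM e1 mul1r; congr (_ + _).
  rewrite /as' /coefs /mkseq big_map /index_iota subn0.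
  by apply: eq_bigr => k _; rewrite normrM e1 mul1r.
have linab : \sum_(0 <= k < n.+1) a k * b k <= e * a 0 + lin as' bs.
  have nM : (n <= M)%N by rewrite leq_maxr.
  rewrite big_nat_recl// lin_coefs (big_cat_nat (n := n) (p := M))//=.
  rewrite [X in _ <= _ + (_ + X)]big_nat_cond [X in _ <= _ + (_ + X)]big1.
    rewrite addr0 ea; apply: lerD.
      by apply: le_trans (ler_norm _) _; rewrite normrM ler_piMr.
    rewrite le_eqVlt; apply/orP; left; apply/eqP; apply: eq_big_nat => k kn.
    by case/andP: kn => _ kn; rewrite /b' kn mulrACA ee mul1r.
  move=> k /andP[/andP[nk _] _]; rewrite /b' ifF ?mulr0//.
  by rewrite leqNgt ltnS nk.
have [mP iP] : measurable_fun D (fun t => (M1 + e * psum a M.+1 t) * G t) /\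
    (\int[mu]_(t in D) ((M1 + e * psum a M.+1 t) * G t)%:E =
    (M1 + (e * a 0 + lin as' bs))%:E)%E.
  have [||mP iP] := @integral01 _ M
    (fun s => (M1 + e * a 0 + lin as' s) * riesz bs s)
    (fun t => (M1 + e * psum a M.+1 t) * G t).
  - move=> s s1; have /andP[r0 _] := riesz_bounds bs1 s1.
    rewrite mulr_ge0// M1E; have := lin_le as' s1.
    by rewrite ler_norml => /andP[h1 _]; have := ler_norm (- (e * a 0));
      rewrite normrN; lra.
  - move=> t t01; rewrite -/(G t) /G; congr (_ * _).
    rewrite -addrA -(psum_lin _ _ t01); congr (_ + _).
    rewrite !psumE mulr_sumr; apply: eq_bigr => k _; exact: mulrA.
  split=> //; rewrite iP -{1}szb avg_lin_riesz ?addrA//.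
  by rewrite szb size_mkseq.
pose w t := x0 t + x1 t - psum a M.+1 t.
have mw : meas01 w.
  by apply: measurable_funB; [exact: measurable_funD|exact: measurable_psum].
have ew : (\int[mu]_(t in D) (expR ((w t / del) ^+ 2))%:E <= 2%:E)%E.
  apply: (integral_exp_rsum tM) => //; first by rewrite mulrC divfK.
  apply: (ae01_imply _ (ae01_and xa (rsum_tail M.+1 aB))) => t _ [xt ->].
  by rewrite /w xt.
pose c1 := M1 + A + 2 * tau * u.
pose c2 := 2^-1 * u * expR (- tau ^+ 2).
have tau0 : 0 <= tau by lra.
have c10 : 0 <= c1 by rewrite !addr_ge0// !mulr_ge0// ltW.
have c20 : 0 <= c2 by rewrite !mulr_ge0 ?expR_ge0// ltW.
have G0 t : 0 <= G t by case/andP: (G0L t).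
have uL0 : 0 <= L * del by rewrite mulr_ge0// ltW.
(* The majorant of the integrand, assembled from its four terms. *)
have [q10 mq1 iq1] := integral_lincomb_le c10 c20 G0 (fun t => sqr_ge0 (G t)) mG
  (measurable_funX 2 mG) (eq_ind_r (fun z => (z <= 1%:E)%E) (lexx _) iG) iG2.
have [q20 mq2 iq2] := integral_lincomb_le (ltW u0) uL0 (fun t => expR_ge0 _)
  (fun t => expR_ge0 _) (measurable_exp_sqr u m1) (measurable_exp_sqr del mw)
  ex1 ew.
have [q0 mq iq] := integral_lincomb_le ler01 ler01 q10 q20 mq1 mq2 iq1 iq2.
have key : (\int[mu]_(t in D) ((M1 + e * psum a M.+1 t) * G t)%:E <=
   (1 * (c1 * 1 + c2 * expR (tau ^+ 2)) + 1 * (u * 2 + L * del * 2))%:E)%E.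
  apply: le_trans iq; apply: ae_ge0_le_integral => //.
  - move=> t _; rewrite lee_fin mulr_ge0//.
    by have := psM t; rewrite ler_norml => /andP[]; lra.
  - exact/measurable_EFinP.
  - by move=> t _; rewrite lee_fin; exact: q0.
  - exact/measurable_EFinP.
  apply: (ae01_imply _ x0A) => t Dt x0t; rewrite lee_fin.
  have Ge := G0 t; have /andP[_ GL] := G0L t.
  have h1 := @young_exp _ (`|x1 t| / u) (G t) tau
    (divr_ge0 (normr_ge0 _) (ltW u0)) Ge tau0.
  have h2 := le_exp_sqr (`|w t| / del).
  have sqE (y v : R) : (`|y| / v) ^+ 2 = (y / v) ^+ 2.
    by rewrite !exprMn real_normK ?num_real.
  rewrite !sqE in h1 h2.
  rewrite ler_pdivrMr// in h2.
  have {}h1 : `|x1 t| * G t <= u * (2 * tau * G t +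
      2^-1 * expR (- tau ^+ 2) * G t ^+ 2 + expR ((x1 t / u) ^+ 2)).
    by rewrite -ler_pdivrMl//; apply: le_trans h1; rewrite mulrA [u^-1 * _]mulrC.
  have h3 : `|w t| * G t <= L * del * expR ((w t / del) ^+ 2).
    rewrite mulrC -mulrA [del * _]mulrC; apply: ler_pM => //.
  have h4 : `|x0 t| * G t <= A * G t by rewrite ler_wpM2r.
  have h5 : e * psum a M.+1 t <= `|x0 t| + `|x1 t| + `|w t|.
    apply: le_trans (ler_norm _) _; rewrite normrM e1 mul1r.
    have -> : psum a M.+1 t = x0 t + x1 t - w t by rewrite /w; ring.
    apply: le_trans (ler_normB _ _) _; rewrite lerD2r; exact: ler_normD.
  have h6 : e * psum a M.+1 t * G t <= (`|x0 t| + `|x1 t| + `|w t|) * G t.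
    by rewrite ler_wpM2r.
  rewrite /c1 /c2; lra.
move: key; rewrite iP lee_fin /c1 /c2.
have pq : expR (- tau ^+ 2) * expR (tau ^+ 2) = 1.
  by rewrite -expRD addrC subrr expR0.
have -> : 2^-1 * u * expR (- tau ^+ 2) * expR (tau ^+ 2) = 2^-1 * u.
  by rewrite -mulrA pq mulr1.
have -> : L * del * 2 = eps by rewrite /del; field; rewrite gt_eqF.
have : u <= u * tau by rewrite ler_peMr// ltW.
lra.
Qed.

End riesz_products.

(** * The couple of sequence spaces *)

Section sequence_spaces.
Context {R : realType}.
Implicit Types (a b : nat -> R) (u : nat -> R).

Lemma nneseries_leP u (B : R) : (forall k, 0 <= u k) ->
  ((\sum_(0 <= k <oo) (u k)%:E <= B%:E)%E <->
   forall n, \sum_(0 <= k < n) u k <= B).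
Proof.
move=> u0; have uE0 k : (0 <= k)%N -> true -> (0%E <= (u k)%:E)%E.
  by rewrite lee_fin.
split=> [h n|h].
  rewrite -lee_fin -sumEFin; apply: le_trans h; apply: nneseries_lim_ge => k _ _.
  by rewrite lee_fin.
apply: lime_le; first exact: is_cvg_nneseries.
by apply: nearW => n; rewrite sumEFin lee_fin.
Qed.

Definition l1_le a (B : R) := forall n, \sum_(0 <= k < n) `|a k| <= B.

Lemma lnorm_ge0 (p : R) a : (0 <= lnorm p a)%E.
Proof. exact: poweR_ge0. Qed.

Lemma lnorm1_leP a (B : R) : (lnorm 1 a <= B%:E)%E <-> l1_le a B.
Proof.
rewrite /lnorm invr1.
under eq_eseriesr do rewrite powRr1//.
rewrite poweRe1; first exact: nneseries_leP.
by apply: nneseries_ge0 => k _ _; rewrite lee_fin.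
Qed.

Lemma lnorm2_leP a (x : R) : 0 <= x ->
  ((lnorm 2 a <= x%:E)%E <-> l2_le a (x ^+ 2)).
Proof.
move=> x0; rewrite /lnorm.
under eq_eseriesr do rewrite powR_mulrn// real_normK ?num_real//.
have a0 k : 0 <= a k ^+ 2 by exact: sqr_ge0.
apply: (iff_trans _ (nneseries_leP _ a0)).
have : (0 <= \sum_(0 <= k <oo) (a k ^+ 2)%:E)%E.
  by apply: nneseries_ge0 => k _ _; rewrite lee_fin.
case: (\sum_(0 <= k <oo) _)%E => [r r0|_|//].
  rewrite lee_fin in r0; rewrite poweR_EFin !lee_fin powR12_sqrt//.
  rewrite -(ler_pXn2r (n := 2))// ?nnegrE ?sqrtr_ge0// sqr_sqrtr//.
by rewrite poweRyr ?invr_eq0 ?pnatr_eq0//.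
Qed.

Lemma elts_l1P a : elts (lspace 1) a <-> exists B, l1_le a B.
Proof.
rewrite /=; split=> [h|[B /lnorm1_leP aB]]; last exact: le_lt_trans aB (ltry _).
exists (fine (lnorm 1 a)); apply/lnorm1_leP; rewrite fineK//.
by rewrite ge0_fin_numE// lnorm_ge0.
Qed.

Lemma elts_l2_norm a : elts (lspace 2) a ->
  exists x, [/\ 0 <= x, lnorm 2 a = x%:E & l2_le a (x ^+ 2)].
Proof.
move=> /= h; have f : lnorm 2 a \is a fin_num by rewrite ge0_fin_numE// lnorm_ge0.
exists (fine (lnorm 2 a)).
have x0 : 0 <= fine (lnorm 2 a) by rewrite fine_ge0// lnorm_ge0.
by split=> //; [rewrite fineK|apply/lnorm2_leP => //; rewrite fineK].
Qed.

Lemma elts_l2P a : elts (lspace 2) a <-> exists B, l2_le a B.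
Proof.
split=> [/elts_l2_norm[x [_ _ ?]]|[B aB]]; first by exists (x ^+ 2).
have B0 : 0 <= B by have := aB 0; rewrite big_geq.
have : l2_le a (Num.sqrt B ^+ 2) by rewrite sqr_sqrtr.
move=> /lnorm2_leP h; apply: le_lt_trans (h _) (ltry _); exact: sqrtr_ge0.
Qed.

Lemma l1_le_l2 a B : l1_le a B -> l2_le a (B ^+ 2).
Proof.
move=> aB n; apply: (@le_trans _ _ ((\sum_(0 <= k < n) `|a k|) ^+ 2)); last first.
  by rewrite lerXn2r// ?nnegrE ?sumr_ge0//; have := aB 0; rewrite big_geq.
elim: n => [|n IH]; first by rewrite !big_geq// expr0n.
rewrite !big_nat_recr//= sqrrD real_normK ?num_real// lerD2r.
by apply: le_trans IH _; rewrite lerDl mulrn_wge0// mulr_ge0// sumr_ge0.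
Qed.

Lemma l1_le_lin a b (c A B : R) : l1_le a A -> l1_le b B ->
  l1_le (fun k => c * a k + b k) (`|c| * A + B).
Proof.
move=> aA bB n; apply: (@le_trans _ _
  (\sum_(0 <= k < n) (`|c| * `|a k| + `|b k|))).
  by apply: ler_sum => k _; rewrite -normrM ler_normD.
by rewrite big_split/= -mulr_sumr lerD// ler_wpM2l.
Qed.

Lemma l2_le_lin a b (c A B : R) : l2_le a A -> l2_le b B ->
  l2_le (fun k => c * a k + b k) (2 * c ^+ 2 * A + 2 * B).
Proof.
move=> aA bB n; apply: (@le_trans _ _
  (\sum_(0 <= k < n) (2 * c ^+ 2 * a k ^+ 2 + 2 * b k ^+ 2))).
  apply: ler_sum => k _; have := sqr_ge0 (c * a k - b k).
  have -> : 2 * c ^+ 2 * a k ^+ 2 = 2 * (c * a k) ^+ 2 by ring.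
  by set x := c * a k; nra.
rewrite big_split/= -!mulr_sumr lerD// ler_wpM2l//.
by rewrite mulr_ge0// sqr_ge0.
Qed.

(** This is x / l truncated to [-1, 1]. *)
Definition clip (l x : R) := x / Num.max l `|x|.

Section clip.
Context (l : R) (l0 : 0 < l).

Let m0 (x : R) : 0 < Num.max l `|x|. Proof. by rewrite lt_max l0. Qed.

Lemma clip_le1 x : `|clip l x| <= 1.
Proof.
rewrite normrM normfV (gtr0_norm (m0 x)) ler_pdivrMr// mul1r.
by rewrite le_max lexx orbT.
Qed.

Lemma normr_mul_clip x : x * clip l x = `|x| * `|clip l x|.
Proof.
rewrite normrM normfV (gtr0_norm (m0 x)) /clip !mulrA; congr (_ / _).
by rewrite -!expr2 real_normK ?num_real.
Qed.

Lemma clip_le x : l * `|clip l x| <= `|x|.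
Proof.
rewrite normrM normfV (gtr0_norm (m0 x)) mulrA ler_pdivrMr// mulrC.
by rewrite ler_wpM2l// le_max lexx.
Qed.

Lemma clip_rest x : `|x - l * clip l x| <= x * clip l x.
Proof.
set m := Num.max l `|x|.
have m0x := m0 x; rewrite -/m in m0x.
have -> : x - l * clip l x = x * (m - l) / m.
  by rewrite /clip -/m; field; rewrite gt_eqF.
have lm : l <= m by rewrite le_max lexx.
rewrite normr_mul_clip !normrM normfV (gtr0_norm m0x) mulrA.
rewrite ler_pM2r ?invr_gt0// ler_wpM2l// ger0_norm ?subr_ge0//.
by rewrite lerBlDr ge_max lerDr normr_ge0 lerDl ltW.
Qed.

Lemma clip_half x : `|clip (l / 2) x| <= 2 * `|clip l x|.
Proof.
have m'0 : 0 < Num.max (l / 2) `|x| by rewrite lt_max divr_gt0.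
rewrite !normrM !normfV (gtr0_norm (m0 x)) (gtr0_norm m'0).
rewrite mulrCA ler_wpM2l// -ler_pdivrMl// -invfM lef_pV2 ?posrE ?mulr_gt0//.
rewrite mulrC ge_max; apply/andP; split.
  by rewrite -ler_pdivrMr// le_max lexx.
rewrite -ler_pdivrMr// le_max; apply/orP; right.
by rewrite ler_pdivrMr// ler_peMr// ler1n.
Qed.

End clip.

(** Going down the levels L / 2^j from one where the constraint holds, either
    the levels become as small as desired or there is a last one at which it
    holds; the alternative says that [l] is nearly zero or within a factor 2
    of violating the constraint. *)
Lemma clip_level a (S t eps : R) : l2_le a S -> 0 < t -> 0 < eps ->
  exists l, [/\ 0 < l, l2_le (clip l \o a) (t ^+ 2) &
    l * t ^+ 2 <= eps \/ ~ l2_le (clip (l / 2) \o a) (t ^+ 2)].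
Proof.
move=> aS t0 eps0.
have S0 : 0 <= S by have := aS 0; rewrite big_geq.
pose L := (S + 1) / t + 1 / t.
have t2 : 0 < t ^+ 2 by rewrite exprn_gt0.
have L0 : 0 < L by rewrite addr_gt0// divr_gt0//; lra.
have LS : S <= L ^+ 2 * t ^+ 2.
  rewrite -exprMn (_ : L * t = S + 2); first by nra.
  by rewrite /L; field; rewrite gt_eqF.
have PL : l2_le (clip L \o a) (t ^+ 2).
  move=> n; have L2 : 0 < L ^+ 2 by rewrite exprn_gt0.
  rewrite -(ler_pM2l L2); apply: le_trans LS; apply: le_trans (aS n).
  rewrite mulr_sumr; apply: ler_sum => k _ /=.
  rewrite -exprMn -(real_normK (num_real (a k))) -(real_normK (num_real (L * _))).
  rewrite lerXn2r ?nnegrE// normrM (gtr0_norm L0); exact: clip_le.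
pose l j := L / 2 ^+ j.
have lj0 j : 0 < l j by rewrite divr_gt0// exprn_gt0.
have [allP|] := pselect (forall j, l2_le (clip (l j) \o a) (t ^+ 2)).
  have [j hj] : exists j, l j * t ^+ 2 <= eps.
    have e0 : 0 < eps / (L * t ^+ 2) by rewrite divr_gt0// mulr_gt0.
    have [j] := ltr_add_invr e0; rewrite add0r => hj; exists j.
    rewrite /l mulrAC ler_pdivrMr ?exprn_gt0//.
    rewrite ltr_pdivlMr ?mulr_gt0// ltr_pdivrMl// in hj.
    apply: le_trans (ltW hj) _; rewrite mulrC ler_pM2l// -natrX ler_nat.
    exact: ltn_expl.
  by exists (l j); split=> //; left.
move=> /existsNP ex.
have [j nP minj] : exists2 j, ~ l2_le (clip (l j) \o a) (t ^+ 2) &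
    forall i, (i < j)%N -> l2_le (clip (l i) \o a) (t ^+ 2).
  have ex' : exists j, `[< ~ l2_le (clip (l j) \o a) (t ^+ 2) >].
    by have [j hj] := ex; exists j; apply/asboolP.
  exists (ex_minn ex'); case: ex_minnP => j /asboolP// hj mj i ij.
  apply: contrapT => /asboolP /mj; by rewrite leqNgt ij.
case: j nP minj => [|j] nP minj.
  by case: nP; rewrite /l expr0 divr1.
exists (l j); split=> //; first exact: minj.
right; suff <- : l j.+1 = l j / 2 by [].
by rewrite /l exprS; field; rewrite expf_neq0.
Qed.

(** For b = clip l a the vectors a - l b and l b are the large and the flat
    part of a.  Every entry of a - l b is at most a_k b_k in absolute value,
    so its l_1 norm is at most B.  Also l |b|_2^2 <= sum_k a_k b_k <= B.  If the
    level l saturates the constraint, |b|_2 >= t / 2, this gives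
    t l |b|_2 <= 2 l |b|_2^2 <= 2 B; if no level does, l b has arbitrarily small
    norm. *)
Lemma K_l1_l2_le_dual a (S t B : R) : l2_le a S -> 0 < t ->
  (forall b, (forall k, `|b k| <= 1) -> l2_le b (t ^+ 2) ->
    forall n, \sum_(0 <= k < n) a k * b k <= B) ->
  (K_functional eq (lspace 1) (lspace 2) t a <= (3 * B)%:E)%E.
Proof.
move=> aS t0 HB; apply/lee_addgt0Pr => eps eps0.
have [l [l0 Pl alt]] := clip_level aS t0 eps0.
pose b := clip l \o a.
have abB : forall n, \sum_(0 <= k < n) a k * b k <= B.
  by apply: HB => // k; exact: clip_le1.
have B0 : 0 <= B by have := abB 0; rewrite big_geq.
have n0 : l1_le (fun k => a k - l * b k) B.
  move=> n; apply: le_trans (abB n); apply: ler_sum => k _; exact: clip_rest.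
have sqE n : \sum_(0 <= k < n) (l * b k) ^+ 2 = l ^+ 2 * \sum_(0 <= k < n) b k ^+ 2.
  by rewrite mulr_sumr; apply: eq_bigr => k _; rewrite exprMn.
have n1 : l2_le (fun k => l * b k) (((2 * B + eps) / t) ^+ 2).
  have t2 : 0 < t ^+ 2 by rewrite exprn_gt0.
  case: alt => [small|/existsNP[n /negP]] => [N|].
    rewrite sqE exprMn exprVn ler_pdivlMr//.
    apply: (@le_trans _ _ ((l * t ^+ 2) ^+ 2)).
      have := Pl N; rewrite -/b; set s := \sum_(_ <= _ < _) _ => hs.
      have -> : (l * t ^+ 2) ^+ 2 = l ^+ 2 * t ^+ 2 * t ^+ 2 by ring.
      by rewrite ler_pM2r// ler_pM2l ?exprn_gt0.
    by rewrite lerXn2r ?nnegrE//; [by rewrite mulr_ge0 ?ltW|lra|lra].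
  rewrite -ltNge => hn N; rewrite sqE exprMn exprVn ler_pdivlMr//.
  pose M := maxn N n.
  have mono (p q : nat) : (p <= q)%N ->
      \sum_(0 <= k < p) b k ^+ 2 <= \sum_(0 <= k < q) b k ^+ 2.
    move=> pq; rewrite [leRHS](big_cat_nat (n := p))//= lerDl sumr_ge0// => k _.
    exact: sqr_ge0.
  have sN := mono _ _ (leq_maxl N n); have sn := mono _ _ (leq_maxr N n).
  have s4 : t ^+ 2 <= 4 * \sum_(0 <= k < n) b k ^+ 2.
    apply: le_trans (ltW hn) _; rewrite mulr_sumr; apply: ler_sum => k _ /=.
    rewrite -(real_normK (num_real (clip _ _))) -(real_normK (num_real (b k))).
    have -> : 4 * `|b k| ^+ 2 = (2 * `|b k|) ^+ 2 by ring.
    by rewrite lerXn2r ?nnegrE// clip_half.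
  have ls : l * \sum_(0 <= k < M) b k ^+ 2 <= B.
    apply: le_trans (abB M); rewrite mulr_sumr; apply: ler_sum => k _.
    rewrite -(real_normK (num_real (b k))) expr2 mulrA normr_mul_clip//.
    by rewrite ler_wpM2r// clip_le.
  rewrite -/M in sN sn.
  set s := \sum_(0 <= k < M) _ in sN sn ls; set sn' := \sum_(0 <= k < n) _ in sn s4.
  set sN' := \sum_(0 <= k < N) _ in sN *.
  have sN0 : 0 <= sN' by apply: sumr_ge0 => k _; exact: sqr_ge0.
  have s0 : 0 <= s by exact: le_trans sN0 sN.
  apply: (@le_trans _ _ (4 * (l * s) ^+ 2)).
    have -> : 4 * (l * s) ^+ 2 = l ^+ 2 * s * (4 * s) by ring.
    have l2 := sqr_ge0 l.
    apply: ler_pM; [exact: mulr_ge0|exact: ltW|exact: ler_wpM2l|lra].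
  have -> : 4 * (l * s) ^+ 2 = (2 * (l * s)) ^+ 2 by ring.
  have ls0 : 0 <= l * s by rewrite mulr_ge0// ltW.
  by rewrite lerXn2r ?nnegrE//; lra.
have e : (0 <= (2 * B + eps) / t) by rewrite divr_ge0 ?(ltW t0)//; lra.
apply: (@le_trans _ _ (lnorm 1 (fun k => (a k - l * b k)%R) +
    t%:E * lnorm 2 (fun k => (l * b k)%R))%E).
  apply: ereal_inf_lbound; exists ((fun k => a k - l * b k), (fun k => l * b k)) => //.
  split=> /=.
  - by apply/elts_l1P; exists B.
  - by apply/elts_l2P; eexists; exact: n1.
  - by apply/funext => k /=; rewrite subrK.
apply: (@le_trans _ _ (B%:E + t%:E * ((2 * B + eps) / t)%:E)%E).
  apply: leeD; first exact/lnorm1_leP.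
  by apply: lee_wpmul2l; [rewrite lee_fin ltW|apply/lnorm2_leP].
by rewrite -EFinM -EFinD -EFinD lee_fin mulrCA divff ?gt_eqF// mulr1; lra.
Qed.

End sequence_spaces.

(** * Generalities on the K-functional *)

Section K_functional_theory.
Context {R : realType}.

Lemma K_functional_le_decomp (V : lmodType R) (eqv : V -> V -> Prop)
    (X0 X1 : nspace V) (t : R) (x x0 x1 : V) :
  elts X0 x0 -> elts X1 x1 -> eqv x (x0 + x1) ->
  (K_functional eqv X0 X1 t x <= nrm X0 x0 + t%:E * nrm X1 x1)%E.
Proof. by move=> ? ? ?; apply: ereal_inf_lbound; exists (x0, x1). Qed.

Lemma K_functional_le (V W : lmodType R) (eqv : V -> V -> Prop)
    (eqw : W -> W -> Prop) (X0 X1 : nspace V) (Y0 Y1 : nspace W)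
    (s t C : R) (x : V) (y : W) : 0 < C ->
  (forall x0 x1, elts X0 x0 -> elts X1 x1 -> eqv x (x0 + x1) ->
    (K_functional eqw Y0 Y1 s y <= C%:E * (nrm X0 x0 + t%:E * nrm X1 x1))%E) ->
  (K_functional eqw Y0 Y1 s y <= C%:E * K_functional eqv X0 X1 t x)%E.
Proof.
move=> C0 h; rewrite -lee_pdivrMl//.
apply: le_ereal_inf_tmp => _ [[x0 x1] /= [e0 e1 ex] <-].
by rewrite lee_pdivrMl//; exact: h.
Qed.

End K_functional_theory.

(** * The norms of L_oo and of the Orlicz space on Rademacher series *)

Section function_spaces.
Context {R : realType}.
Local Notation mu := (@lebesgue_measure R).
Local Notation D := (`[0, 1]%classic : set R).
Implicit Types (a b : nat -> R) (f : R -> R).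

Lemma ae_leb01 (P : R -> Prop) :
  (\forall x \ae (leb01 R), P x) <-> {ae mu, forall t, D t -> P t}.
Proof.
split=> [[N [mN N0 sN]]|[N [mN N0 sN]]].
  exists (N `&` D); split; first exact: measurableI.
  - exact: N0.
  - by move=> t /= /not_implyP[Dt nP]; split=> //; exact: sN.
exists (N `|` ~` D); split.
- by apply: measurableU => //; exact: measurableC.
- change (mu ((N `|` ~` D) `&` D) = 0)%E; rewrite setIUl setICl setU0.
  by apply: (subset_measure0 _ _ _ N0) => //; exact: measurableI.
- move=> t /= nP; have [Dt|] := pselect (D t); last by right.
  by left; apply: sN => /= h; exact: nP (h Dt).
Qed.

Lemma Linfty_leP f (B : R) :
  (nrm (Linfty R) f <= B%:E)%E <-> {ae mu, forall t, D t -> `|f t| <= B}.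
Proof.
rewrite /= unlock ifT; last first.
  change (0 < mu (setT `&` D))%E; rewrite setTI lebesgue_measure_itv/=.
  by rewrite lte_fin ltr01 sube0 lte_fin.
apply: iff_trans (ae_leb01 _).
have aeF : Filter (nbhs (almost_everywhere (leb01 R))).
  exact: (ae_filter_ringOfSetsType (leb01 R)).
split=> [/ess_supP h|h]; last first.
  by apply/ess_supP; move: h; apply: (@filterS _ _ aeF) => t /=; rewrite lee_fin.
by move: h; apply: (@filterS _ _ aeF) => t /=; rewrite lee_fin.
Qed.

Lemma Linfty_ge0 f : (0 <= nrm (Linfty R) f)%E.
Proof. exact: Lnorm_ge0. Qed.

Lemma Linfty_bounded f : elts (Linfty R) f -> exists B,
  [/\ 0 <= B, nrm (Linfty R) f = B%:E & {ae mu, forall t, D t -> `|f t| <= B}].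
Proof.
move=> [_ h].
have fn : nrm (Linfty R) f \is a fin_num by rewrite ge0_fin_numE// Linfty_ge0.
exists (fine (nrm (Linfty R) f)); split.
- by rewrite fine_ge0// Linfty_ge0.
- by rewrite fineK.
- by apply/Linfty_leP; rewrite fineK.
Qed.

Lemma orlicz_ge0 S f : (0 <= @orlicz_norm R S f)%E.
Proof.
by apply: le_ereal_inf_tmp => _ [u [u0 _] <-]; rewrite lee_fin ltW.
Qed.

(** The exponential bound holds for every scale u > 0 with u >= 4 x; the
    infimum over u also covers x = 0, where u = 4 x would be excluded. *)
Lemma rsum_orlicz_le a f (x : R) : l2_le a (x ^+ 2) -> 0 <= x -> meas01 f ->
  ae01 f (rsum a) -> (orlicz_norm (@expsq R) f <= (4 * x)%:E)%E.
Proof.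
move=> ax x0 mf fa; apply/lee_addgt0Pr => e e0; rewrite -EFinD.
apply: ereal_inf_lbound; exists (4 * x + e) => //; split; first lra.
rewrite -(leeD2rE _ _ (_ : 1%E \is a fin_num))// -integral_expsq//.
by apply: (integral_exp_rsum ax) => //; [lra|nra].
Qed.

Lemma rsum_Linfty_le a f (x : R) : l1_le a x ->
  ae01 f (rsum a) -> (nrm (Linfty R) f <= x%:E)%E.
Proof.
move=> ax fa; apply/Linfty_leP.
apply: (ae01_imply _ (ae01_and fa (psum_rsum_ae (l1_le_l2 ax)))) => t _ [-> cv].
have cB : closed [set y : R | `|y| <= x].
  rewrite (_ : [set y | _] = `[- x, x]%classic); first exact: interval_closed.
  by apply/seteqP; split=> y /=; rewrite in_itv/= -ler_norml.
apply: (closed_cvg _ cB _ _ cv).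
apply: nearW => n /=; rewrite psumE.
apply: le_trans (ler_norm_sum _ _ _) (le_trans _ (ax n)).
by apply: ler_sum => k _; rewrite normrM ler_piMr// rademacher_le1.
Qed.

(** * Comparison of the couples *)

Section couples.
Local Notation Y0 := (rsum_image (elts (lspace 1)) (Linfty R)).
Local Notation Y1 := (rsum_image (elts (lspace 2)) (Gspace R)).
Local Notation X0 := (Linfty R).
Local Notation X1 := (Gspace R).

Lemma rsum_trunc a m : rsum (fun k => if (k < m)%N then a k else 0) = psum a m.
Proof.
apply/funext => t; apply: cvg_lim => //.
have c : psum a m t @[_ --> \oo] --> psum a m t by exact: cvg_cst.
apply: cvg_trans c; apply: near_eq_cvg.
exists m => // n /= mn; rewrite psumE /series /= [RHS](big_cat_nat (n := m))//=.
rewrite [X in _ = _ + X]big_nat_cond [X in _ = _ + X]big1 ?addr0; last first.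
  by move=> k /andP[/andP[mk _] _]; rewrite ltnNge mk mul0r.
by apply: eq_big_nat => k /andP[_ ->].
Qed.

(** The partial sums are bounded, and they approximate [f] in the norm of L_N
    since the difference is the series of a tail of [a]. *)
Lemma rsum_G a B f : l2_le a B -> meas01 f -> ae01 f (rsum a) -> elts X1 f.
Proof.
move=> aB mf fa.
have B0 : 0 <= B by have := aB 0; rewrite big_geq.
have aS : l2_le a (Num.sqrt B ^+ 2) by rewrite sqr_sqrtr.
split.
  split=> //; apply: le_lt_trans (ltry _).
  exact: (rsum_orlicz_le aS (sqrtr_ge0 _) mf fa).
move=> e e0.
have e8 : 0 < (e / 8) ^+ 2 by rewrite exprn_gt0// divr_gt0.
have [m hm] := l2_tail_small aB e8.
exists (psum a m); split.
- split; first exact: measurable_psum.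
  apply: le_lt_trans (ltry (\sum_(0 <= k < m) `|a k|)).
  apply/Linfty_leP; apply: (aeW mu) => t _; rewrite psumE.
  apply: le_trans (ler_norm_sum _ _ _) _.
  by apply: ler_sum => k _; rewrite normrM ler_piMr// rademacher_le1.
- split; first exact: measurable_psum.
  apply: le_lt_trans (ltry _).
  apply: (@rsum_orlicz_le (fun k => if (k < m)%N then a k else 0) _ (Num.sqrt B)).
  + move=> n; rewrite sqr_sqrtr//; apply: le_trans (aB n).
    by apply: ler_sum => k _; case: ifP; rewrite ?expr0n/= ?sqr_ge0.
  + exact: sqrtr_ge0.
  + exact: measurable_psum.
  + by rewrite rsum_trunc; exact: ae_eq_refl.
- apply: (@le_lt_trans _ _ (4 * (e / 8))%:E); last by rewrite lte_fin; lra.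
  apply: (rsum_orlicz_le (hm m (leqnn m))).
  + by rewrite ltW// divr_gt0.
  + exact: measurable_funB mf (measurable_psum _ _).
  + by apply: (ae01_imply _ (ae01_and fa (rsum_tail m aB))) => t _ [ft ->]; rewrite /= -ft.
Qed.

Lemma rsum_Linfty a B f : l1_le a B -> meas01 f -> ae01 f (rsum a) -> elts X0 f.
Proof.
by move=> aB mf fa; split=> //; exact: le_lt_trans (rsum_Linfty_le aB fa) (ltry _).
Qed.

Lemma elts_rsum_l1 f : elts Y0 f ->
  exists a B, [/\ l1_le a B, meas01 f & ae01 f (rsum a)].
Proof. by move=> [mf [a /elts_l1P[B aB] fa]]; exists a, B. Qed.

Lemma elts_rsum_l2 f : elts Y1 f ->
  exists a B, [/\ l2_le a B, meas01 f & ae01 f (rsum a)].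
Proof. by move=> [mf [a /elts_l2P[B aB] fa]]; exists a, B. Qed.

Lemma rsum0 : rsum (fun=> 0 : R) = 0.
Proof.
apply/funext => t; apply: cvg_lim => //.
have c : (0 : R) @[_ --> \oo] --> (0 : R) by exact: cvg_cst.
apply: cvg_trans c; apply: near_eq_cvg; apply: nearW => n; rewrite /series /= big1// => k _.
by rewrite mul0r.
Qed.

Lemma meas01_lin (c : R) f g : meas01 f -> meas01 g -> meas01 (c *: f + g).
Proof.
by move=> mf mg; apply: measurable_funD => //; exact: measurable_funM.
Qed.

Lemma rsum_l1_subspace : is_subspace Y0 X0.
Proof.
split=> //.
- by move=> f /elts_rsum_l1[a [B [aB mf fa]]]; exact: rsum_Linfty aB mf fa.
- split; first exact: measurable_cst.
  exists (fun=> 0); last by rewrite rsum0; exact: ae_eq_refl.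
  by apply/elts_l1P; exists 0 => n; rewrite big1// => k _; rewrite normr0.
- move=> c f g /elts_rsum_l1[a [A [aA mf fa]]] /elts_rsum_l1[b [B [bB mg gb]]].
  split; first exact: meas01_lin.
  exists (fun k => c * a k + b k); first by apply/elts_l1P; eexists; exact: l1_le_lin.
  have h := rsum_lin c (l1_le_l2 aA) (l1_le_l2 bB).
  by apply: (ae01_imply _ (ae01_and h (ae01_and fa gb))) => t _ [-> [<- <-]].
Qed.

Lemma rsum_l2_subspace : is_subspace Y1 X1.
Proof.
split=> //.
- by move=> f /elts_rsum_l2[a [B [aB mf fa]]]; exact: rsum_G aB mf fa.
- split; first exact: measurable_cst.
  exists (fun=> 0); last by rewrite rsum0; exact: ae_eq_refl.
  by apply/elts_l2P; exists 0 => n; rewrite big1// => k _; rewrite expr0n.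
- move=> c f g /elts_rsum_l2[a [A [aA mf fa]]] /elts_rsum_l2[b [B [bB mg gb]]].
  split; first exact: meas01_lin.
  exists (fun k => c * a k + b k); first by apply/elts_l2P; eexists; exact: l2_le_lin.
  have h := rsum_lin c aA bB.
  by apply: (ae01_imply _ (ae01_and h (ae01_and fa gb))) => t _ [-> [<- <-]].
Qed.

Lemma K_rsum_image_le a f (t : R) : 0 < t -> ae01 f (rsum a) ->
  (K_functional (@ae01 R) Y0 Y1 t f <=
   4%:E * K_functional eq (lspace 1) (lspace 2) t a)%E.
Proof.
move=> t0 fa; apply: K_functional_le => // b d b1 d2 abd.
have [x [x0 dn dx]] := elts_l2_norm d2.
have b1n : lnorm 1 b = (fine (lnorm 1 b))%:E by rewrite fineK// ge0_fin_numE// lnorm_ge0.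
have bB : l1_le b (fine (lnorm 1 b)) by apply/lnorm1_leP; rewrite -b1n.
have [fb mb fbb] := rsum_measurable_rep (l1_le_l2 bB).
have [fd md fdd] := rsum_measurable_rep dx.
have h := rsum_lin 1 (l1_le_l2 bB) dx.
apply: le_trans (K_functional_le_decomp t (x0 := fb) (x1 := fd) _ _ _) _.
- by split=> //; exists b.
- by split=> //; exists d.
- apply: (ae01_imply _ (ae01_and fa (ae01_and h (ae01_and fbb fdd)))).
  move=> s _ [fs [hs [fbs fds]]]; change (f s = fb s + fd s).
  rewrite fs fbs fds -[rsum b s]mul1r -hs abd.
  by congr (rsum _ s); apply/funext => k /=; rewrite mul1r.
have n1 := rsum_Linfty_le bB fbb.
have n2 := rsum_orlicz_le dx x0 md fdd.
rewrite [nrm (lspace 1) b]b1n [nrm (lspace 2) d]dn -(EFinM t) -EFinD -EFinM mulrDr.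
rewrite EFinD; apply: leeD.
  apply: le_trans n1 _; rewrite lee_fin ler_peMl//; last by rewrite ler1n.
  by have := bB 0; rewrite big_geq.
rewrite mulrCA EFinM; apply: lee_wpmul2l => //; by rewrite lee_fin ltW.
Qed.

Lemma K_rsum_image_ge f (t : R) : 0 < t ->
  (K_functional (@ae01 R) X0 X1 t f <= K_functional (@ae01 R) Y0 Y1 t f)%E.
Proof.
move=> t0; rewrite -[leRHS]mul1e; apply: K_functional_le => // x0 x1 e0 e1 ex.
rewrite mul1e; apply: K_functional_le_decomp => //.
  by have [+ _ _ _] := rsum_l1_subspace; exact.
by have [+ _ _ _] := rsum_l2_subspace; exact.
Qed.

(** The constant is 3, from [K_l1_l2_le_dual], times 5, from
    [dual_pairing_le]. *)
Lemma K_l1_l2_le_Linfty_G a f (t : R) :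
  0 < t -> elts (lspace 2) a -> ae01 f (rsum a) ->
  (K_functional eq (lspace 1) (lspace 2) t a <=
   15%:E * K_functional (@ae01 R) X0 X1 t f)%E.
Proof.
move=> t0 a2 fa; apply: K_functional_le => // x0 x1 e0 e1 ex.
have [A [A0 -> x0A]] := Linfty_bounded e0.
have [[m1 n1] _] := e1.
have n1n : nrm X1 x1 = (fine (nrm X1 x1))%:E.
  by rewrite fineK// ge0_fin_numE// orlicz_ge0.
rewrite n1n -(EFinM t) -EFinD -EFinM; apply/lee_addgt0Pr => eps eps0.
have [S aS] := (elts_l2P a).1 a2.
have [x [xx0 xn ax]] := elts_l2_norm a2.
have d0 : 0 < eps / (15 * t) by rewrite divr_gt0// mulr_gt0.
have [_ [u [u0 iu] <-] un] : exists2 v, [set u%:E | u in [set u : R | 0 < u /\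
    (\int[mu]_(s in D) (expsq (`|x1 s| / u))%:E <= 1)%E]] v &
    (v < (fine (nrm X1 x1) + eps / (15 * t))%:E)%E.
  apply: contrapT => no.
  suff : ((fine (nrm X1 x1) + eps / (15 * t))%:E <= nrm X1 x1)%E.
    by rewrite n1n lee_fin gerDl leNgt d0.
  apply: le_ereal_inf_tmp => v Sv; rewrite leNgt; apply/negP => lt.
  by apply: no; exists v.
rewrite lte_fin in un.
have xa : ae01 (fun s => x0 s + x1 s) (rsum a).
  by apply: (ae01_imply _ (ae01_and fa ex)) => s _ [<- ->].
have iu2 : (\int[mu]_(s in D) (expR ((x1 s / u) ^+ 2))%:E <= 2%:E)%E.
  by rewrite integral_expsq// (_ : 2 = 1 + 1)// EFinD leeD2r.
have low tau b n := @dual_pairing_le _ a b S A u tau x0 x1 n aS e0.1 m1 A0 x0A u0 iu2 xa.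
have fin : 15 * (A + t * u) <= 15 * (A + t * fine (nrm X1 x1)) + eps.
  have : t * u <= t * (fine (nrm X1 x1) + eps / (15 * t)) by rewrite ler_pM2l// ltW.
  have -> : t * (fine (nrm X1 x1) + eps / (15 * t)) =
     t * fine (nrm X1 x1) + eps / 15 by field; rewrite gt_eqF.
  lra.
rewrite -EFinD; apply: (@le_trans _ _ (15 * (A + t * u))%:E); last by rewrite lee_fin.
have tu : 0 < t * u by rewrite mulr_gt0.
have [t1|t1] := leP 1 t.
  apply: (@le_trans _ _ (3 * (A + 5 * t * u))%:E).
    apply: (K_l1_l2_le_dual aS t0) => b b1 bt [|n].
      by rewrite big_geq// addr_ge0// !mulr_ge0// ltW.
    exact: low.
  by rewrite lee_fin; lra.
have Z0 : 0 <= A + 5 * u by rewrite addr_ge0// mulr_ge0// ltW.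
(* Here b = a / x, which has l_2 norm 1. *)
have xA : x <= A + 5 * u.
  have [x00|xneq] := eqVneq x 0; first by rewrite x00.
  have xp : 0 < x by rewrite lt_def xneq.
  have ak k : `|a k| <= x.
    rewrite -(ler_pXn2r (n := 2))// ?nnegrE// real_normK ?num_real//.
    apply: le_trans (ax k.+1); rewrite big_nat_recr//= lerDr.
    by apply: sumr_ge0 => i _; exact: sqr_ge0.
  have aZ : l2_le a (x * (A + 5 * u)).
    move=> [|n]; first by rewrite big_geq// mulr_ge0.
    have -> : \sum_(0 <= k < n.+1) a k ^+ 2 =
        x * \sum_(0 <= k < n.+1) a k * (a k / x).
      by rewrite mulr_sumr; apply: eq_bigr => k _; field.
    rewrite ler_pM2l// -[5]mulr1; apply: low => //.
    - by move=> k; rewrite normrM normfV (gtr0_norm xp) ler_pdivrMr// mul1r.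
    - move=> p; rewrite expr1n; under eq_bigr do rewrite exprMn exprVn.
      by rewrite -mulr_suml ler_pdivrMr ?exprn_gt0// mul1r.
  have : (lnorm 2 a <= (Num.sqrt (x * (A + 5 * u)))%:E)%E.
    apply/lnorm2_leP; first exact: sqrtr_ge0.
    by rewrite sqr_sqrtr// mulr_ge0.
  rewrite xn lee_fin -(ler_pXn2r (n := 2))// ?nnegrE ?sqrtr_ge0//.
  by rewrite sqr_sqrtr ?mulr_ge0// expr2 ler_pM2l.
apply: (@le_trans _ _ (t * x)%:E).
  apply: le_trans (K_functional_le_decomp t (x0 := fun=> 0) (x1 := a) _ _ _) _.
  - by apply/elts_l1P; exists 0 => n; rewrite big1// => k _; rewrite normr0.
  - exact: a2.
  - by apply/funext => k /=; rewrite add0r.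
  rewrite [nrm _ a]xn -EFinM -[leRHS]add0e; apply: leeD => //.
  by apply/lnorm1_leP => n; rewrite big1// => k _; rewrite normr0.
rewrite lee_fin; nra.
Qed.

End couples.
End function_spaces.

Theorem theorem1 (R : realType) :
  K_subcouple (@ae01 R)
    (rsum_image (elts (lspace 1)) (Linfty R))
    (rsum_image (elts (lspace 2)) (Gspace R))
    (Linfty R) (Gspace R) /\
  asymp (elts (@lspace R 2))
    (fun t a => K_functional eq (lspace 1) (lspace 2) t a)
    (fun t a => K_functional (@ae01 R) (Linfty R) (Gspace R) t (rsum a)).
Proof.
split.
  split; [exact: rsum_l1_subspace|exact: rsum_l2_subspace|].
  (* 60 is the product of the constants 4 and 15 of the two comparisons below. *)
  exists 60^-1, 1; split=> // f t [f0 [f1 [e0 e1 ff]]] t0.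
  have [a [A [aA _ fa]]] := elts_rsum_l1 e0; have [b [B [bB _ fb]]] := elts_rsum_l2 e1.
  have ab2 : elts (lspace 2) (fun k => 1 * a k + b k).
    by apply/elts_l2P; eexists; exact: l2_le_lin (l1_le_l2 aA) bB.
  have fab : ae01 f (rsum (fun k => 1 * a k + b k)).
    have h := rsum_lin 1 (l1_le_l2 aA) bB.
    apply: (ae01_imply _ (ae01_and ff (ae01_and h (ae01_and fa fb)))).
    by move=> s _ [-> [-> [<- <-]]]; rewrite mul1r.
  split; last by rewrite mul1e; exact: K_rsum_image_ge.
  rewrite lee_pdivrMl//; apply: le_trans (K_rsum_image_le t0 fab) _.
  rewrite -lee_pdivlMl//; apply: le_trans (K_l1_l2_le_Linfty_G t0 ab2 fab) _.
  by rewrite lee_pdivlMl// muleA -EFinM (_ : 4 * 15 = 60 :> R)// -natrM.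
exists 15^-1, 4; split=> // a t a2 t0.
have aa : ae01 (rsum a) (rsum a) by exact: ae_eq_refl.
split; first by rewrite lee_pdivrMl//; exact: K_l1_l2_le_Linfty_G.
exact: le_trans (K_rsum_image_ge _ t0) (K_rsum_image_le t0 aa).
Qed.
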